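(* Assume that there is $C>0$ with $d_n+a_n\ge C r_n$ for all $n\in\mathbb N$, that $\limsup_{n\to\infty}a_n/d_n<\infty$, and that $\liminf_{n\to\infty}\theta_n=\infty$. Assume moreover that the minimum of the sequence $(\theta_n)_{n=1}^\infty$ is strict (attained at exactly one index), and let $$\lambda_1:=-\min_{n\in\mathbb N}\theta_n .$$ Then there exist constants $\epsilon>0$, $M\ge1$ and elements $e\in X$, $e^*\in X^*$ such that for any $f\in X$ and all $t\ge0$ $$\bigl\|e^{-\lambda_1t}S_G(t)f-\langle e^*,f\rangle e\bigr\|\le M e^{-\epsilon t}\|f\| .$$
   Context: Indices $n,i,j$ range over the positive integers. Let $(r_i)_{i\ge1},(d_i)_{i\ge1},(a_i)_{i\ge1}$ be real sequences with $r_i>0$ and $d_i\ge0$ for all $i\ge 1$, $a_1=0$, and $a_i>0$ for $i\ge2$. Let $b_{i,j}\ge0$ satisfy $b_{i,j}=0$ for $i\ge j$ and $\sum_{i=1}^{j-1} i\,b_{i,j}=j$ for all $j\ge2$. Put $\theta_i=r_i+a_i+d_i$ and $p_i=a_i+d_i$. Let $X=\{f=(f_n)_{n\ge1}:\ \|f\|=\sum_{n=1}^\infty n|f_n|<\infty\}$. Its dual is $X^*=\{f^*=(f^*_k)_{k\ge1}:\ \|f^*\|_{X^*}=\sup_{k\ge1}\frac1k|f^*_k|<\infty\}$ with the pairing $\langle f^*,f\rangle=\sum_{i=1}^\infty f^*_if_i$. For sequences $x,y$ write $xy=(x_ny_n)_n$. For a sequence $f$ let $\triangle f=(f_1,(f_{n-1}-f_n)_{n\ge2})$.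 The decay operator $A$ is $[Af]_i=r_{i+1}f_{i+1}-\theta_i f_i$, $i\ge1$, with domain $$D(A)=\{f\in X:\ pf\in X,\ \triangle(rf)\in X,\ \lim_{n\to\infty}r_nf_n=0\}.$$ The operator $B$ is $[Bf]_i=\sum_{j=i+1}^\infty a_jb_{i,j}f_j$, $i\ge1$, considered on $D(A)$, where it takes values in $X$. The closure $G$ of $(A+B,D(A))$ generates a $C_0$-semigroup $\{S_G(t)\}_{t\ge0}$ of positive contractions on $X$ (the decay-fragmentation semigroup). The condition $\limsup_{n\to\infty} a_n/d_n<\infty$ is understood to include that $d_n>0$ for all sufficiently large $n$. *)

(* Defs.v *)
From HB Require Import structures.
From mathcomp Require Import all_boot all_order all_algebra.
From mathcomp Require Import all_classical all_reals all_analysis.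

Set Implicit Arguments.
Unset Strict Implicit.
Unset Printing Implicit Defensive.

Import Order.TTheory GRing.Theory Num.Theory.
Import numFieldNormedType.Exports.
Local Open Scope classical_set_scope.
Local Open Scope ring_scope.

(* Indices are shifted by one throughout: the term of index k : nat of a Rocq
   sequence is the term of index k + 1 of the mathematical sequence, so that
   the weight n of the coordinate f_n reads k.+1%:R. *)

Section WeightedL1.
Context {R : realType}.
Implicit Types f g : R^nat.

Definition wterm f : R^nat := fun k => k.+1%:R * `|f k|.

Definition wnorm f : R := limn (series (wterm f)).

Definition wsummable : {pred (R^nat)} :=
  [pred f | `[< cvgn (series (wterm f)) >]].

Lemma wsummableP f : reflect (cvgn (series (wterm f))) (f \in wsummable).
Proof. exact: asboolP. Qed.

Lemma wtermZ c f : wterm (c *: f) = `|c| *: wterm f.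
Proof. by apply/funext => k; rewrite /wterm /= normrM mulrCA. Qed.

Lemma wterm_ge0 f k : 0 <= wterm f k.
Proof. by rewrite mulr_ge0. Qed.

Lemma ler_wtermD f g k : wterm (f + g) k <= wterm f k + wterm g k.
Proof. by rewrite /wterm -mulrDr ler_wpM2l// ler_normD. Qed.

Lemma wsummable_submod_closed : submod_closed wsummable.
Proof.
split=> [|c f g /wsummableP fX /wsummableP gX]; apply/wsummableP.
  rewrite -(scale0r (0 : R^nat)) wtermZ normr0 scale0r.
  rewrite (_ : series 0 = cst 0); first exact: is_cvg_cst.
  by apply/funext => n; rewrite /series/= big1.
apply: (@series_le_cvg _ _ (`|c| *: wterm f + wterm g)) => [n|n|n|].
- exact: wterm_ge0.
- by rewrite addr_ge0 ?mulr_ge0 ?wterm_ge0.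
- by rewrite -wtermZ ler_wtermD.
- exact: is_cvg_seriesD (is_cvg_seriesZ fX) gX.
Qed.

HB.instance Definition _ :=
  GRing.isSubmodClosed.Build R (R^nat) wsummable wsummable_submod_closed.

End WeightedL1.

Record X (R : realType) := MkX { Xseq :> nat -> R ; _ : Xseq \in wsummable }.

HB.instance Definition _ (R : realType) := [isSub for @Xseq R].
HB.instance Definition _ (R : realType) := [Choice of X R by <:].
HB.instance Definition _ (R : realType) := [SubChoice_isSubLmodule of X R by <:].

Section XNorm.
Context {R : realType}.
Implicit Types f g : X R.

Lemma Xcvg f : cvgn (series (wterm f)).
Proof. exact/wsummableP/valP. Qed.

Definition Xnorm f : R := wnorm f.

Lemma Xnorm_triangle f g : Xnorm (f + g) <= Xnorm f + Xnorm g.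
Proof.
rewrite /Xnorm /wnorm -lim_seriesD; [|exact: Xcvg..].
apply: lim_series_le; first exact: Xcvg.
  by apply: is_cvg_seriesD; exact: Xcvg.
by move=> k; exact: ler_wtermD.
Qed.

Lemma XnormZ (c : R) f : Xnorm (c *: f) = `|c| * Xnorm f.
Proof.
by rewrite /Xnorm /wnorm [X in series X](wtermZ c f) lim_seriesZ//; exact: Xcvg.
Qed.

Lemma Xnorm_eq0 f : Xnorm f = 0 -> f = 0.
Proof.
move=> f0; apply/val_inj/funext => k /=; apply/eqP.
have ndf : nondecreasing_seq (series (wterm f)).
  by apply/nondecreasing_series => *; exact: wterm_ge0.
have := nondecreasing_cvgn_le ndf (@Xcvg f) k.+1.
rewrite [limn _]f0 /series /= big_nat_recr//= => le0.
have {le0} : wterm f k <= 0.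
  by apply: le_trans le0; rewrite lerDr sumr_ge0// => *; exact: wterm_ge0.
by rewrite /wterm pmulr_rle0 ?ltr0n// normr_le0.
Qed.

HB.instance Definition _ :=
  Lmodule_isNormed.Build R (X R) Xnorm_triangle XnormZ Xnorm_eq0.

Lemma normXE f : `|f| = wnorm f.
Proof. by []. Qed.

End XNorm.

Definition Xdual {R : realType} (fs : R^nat) : Prop :=
  has_ubound (range (fun k => `|fs k| / k.+1%:R)).

Definition pairing {R : realType} (fs f : R^nat) : R :=
  limn (series (fun i => fs i * f i)).

Section Semigroup.
Context {R : realType} {V : normedModType R}.

(* Only the values S t with 0 <= t are meaningful. *)
Record C0_semigroup (S : R -> V -> V) : Prop := {
  semigroup_linear : forall t, 0 <= t -> linear (S t) ;
  semigroup_bounded : forall t, 0 <= t -> continuous (S t) ;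
  semigroup0 : forall f, S 0 f = f ;
  semigroupD : forall s t f, 0 <= s -> 0 <= t -> S (s + t) f = S s (S t f) ;
  semigroup_cvg : forall f, S t f @[t --> 0^'+] --> f }.

Definition contractive (S : R -> V -> V) : Prop :=
  forall t f, 0 <= t -> `|S t f| <= `|f|.

(* Unbounded operators are represented by their graphs. *)
Definition generator (S : R -> V -> V) : set (V * V) :=
  [set fg : V * V | t^-1 *: (S t fg.1 - fg.1) @[t --> 0^'+] --> fg.2].

End Semigroup.

Definition positive_semigroup {R : realType} (S : R -> X R -> X R) : Prop :=
  forall t (f : X R), 0 <= t -> (forall k, 0 <= f k) -> forall k, 0 <= S t f k.

Section DecayFragmentation.
Context {R : realType}.
Variables (r d a : R^nat) (b : nat -> R^nat).

Definition theta : R^nat := fun i => r i + a i + d i.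

Definition prate : R^nat := fun i => a i + d i.

Definition triangle (f : R^nat) : R^nat :=
  fun n => if n is m.+1 then f m - f m.+1 else f 0%N.

Definition Aop (f : R^nat) : R^nat :=
  fun i => r i.+1 * f i.+1 - theta i * f i.

Definition Bop (f : R^nat) : R^nat :=
  fun i => limn (series (fun k =>
    let j := (i.+1 + k)%N in a j * b i j * f j)).

Definition domA : set (X R) :=
  [set f | [/\ (fun n => prate n * f n) \in wsummable,
               triangle (fun n => r n * f n) \in wsummable &
               (r n * f n) @[n --> \oo] --> (0 : R)]].

(* Graph of A + B on domA; under the assumptions on the coefficients,
   A f + B f belongs to X for every f in domA. *)
Definition graphAB : set (X R * X R) :=
  [set fg : X R * X R | domA fg.1 /\ forall i, fg.2 i = Aop fg.1 i + Bop fg.1 i].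

Record decay_fragmentation_coefficients : Prop := {
  decay_gt0 : forall i, 0 < r i ;
  death_ge0 : forall i, 0 <= d i ;
  frag_first : a 0%N = 0 ;
  frag_gt0 : forall i, (0 < i)%N -> 0 < a i ;
  daughter_ge0 : forall i j, 0 <= b i j ;
  daughter_eq0 : forall i j, (j <= i)%N -> b i j = 0 ;
  daughter_mass : forall j, (0 < j)%N ->
    \sum_(i < j) i.+1%:R * b i j = j.+1%:R }.

(* S is the decay-fragmentation semigroup: the C_0-semigroup of positive
   contractions generated by the closure of A + B. *)
Record decay_fragmentation_semigroup (S : R -> X R -> X R) : Prop := {
  dfs_C0 : C0_semigroup S ;
  dfs_positive : positive_semigroup S ;
  dfs_contractive : contractive S ;
  dfs_generator : generator S = closure graphAB }.

End DecayFragmentation.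

(* Main.v *)
(* Decay and fragmentation only move mass towards smaller indices, so A + B is
   an upper triangular matrix with diagonal entries - theta_n. Hence
   lambda1 = - theta_m, m being the index of the minimum, is an eigenvalue with
   a right eigenvector e supported in [1, m] and a left eigenvector e* supported
   in [m, oo), both obtained by triangular recursion. As d_n dominates theta_n
   for large n and tends to infinity, e* belongs to X*, and for a suitable
   weight equivalent to n, the weighted l^1 norm of the coordinates other than
   m satisfies a dissipativity estimate with a rate larger than theta_m on
   finitely supported elements of ker e*. Finitely supported sequences form a
   core, so the estimate passes to the generator and yields exponential decay
   of the semigroup on ker e*, where that norm is equivalent to the norm of X. *)

Require Import Defs.
From HB Require Import structures.
From mathcomp Require Import all_boot all_order all_algebra.
From mathcomp Require Import all_classical all_reals all_analysis.
From mathcomp Require Import ring lra.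

Set Implicit Arguments.
Unset Strict Implicit.
Unset Printing Implicit Defensive.

Import Order.TTheory GRing.Theory Num.Theory.
Import numFieldNormedType.Exports.
Local Open Scope classical_set_scope.
Local Open Scope ring_scope.

(** * Decay of seminorms along contraction semigroups *)

Section ClosureSteps.
Context {R : realType} {V : normedModType R}.

Lemma closure_pairP (D : set (V * V)) (fg : V * V) : closure D fg <->
  forall e, 0 < e -> exists2 fg', D fg' & `|fg.1 - fg'.1| < e /\ `|fg.2 - fg'.2| < e.
Proof.
split=> [Dfg e e0|H B].
  have /Dfg [fg' [Dfg' fgfg']] : nbhs fg (ball fg e) by exact: nbhsx_ballx.
  by exists fg' => //; case: fgfg'; rewrite -!ball_normE.
move=> /nbhs_ballP [e /= e0 eB].
have [fg' Dfg' [fg1 fg2]] := H _ e0.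
by exists fg'; split=> //; apply: eB; split; rewrite -ball_normE.
Qed.

Variable N : V -> R.
Variable K : R.
Hypothesis ND : forall f g, N (f + g) <= N f + N g.
Hypothesis NK : forall f, N f <= K * `|f|.

Lemma seminorm_dist f g : N f <= N g + K * `|f - g|.
Proof. by rewrite -{1}(subrK g f) addrC (le_trans (ND _ _))// lerD2l. Qed.

Hypothesis K0 : 0 <= K.

(** Since [N] is [K]-Lipschitz, both sides depend continuously on the pair [fg], so the inequality
    survives limits in the graph. *)
Lemma dissipative_closure (D : set (V * V)) (w : R) : 0 <= w ->
  (forall fg h, D fg -> 0 < h -> (1 + h * w) * N fg.1 <= N (fg.1 - h *: fg.2)) ->
  forall fg h, closure D fg -> 0 < h ->
    (1 + h * w) * N fg.1 <= N (fg.1 - h *: fg.2).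
Proof.
move=> w0 Dw [f g] h /closure_pairP /= Dfg h0.
set c := 1 + h * w.
have c0 : 0 <= c by rewrite addr_ge0// mulr_ge0// ltW.
apply/ler_addgt0Pr => e e0.
have den0 : 0 < (c + 1 + h) * K + 1.
  by rewrite ltr_wpDl// mulr_ge0// addr_ge0 ?(ltW h0)// addr_ge0.
(* The two comparisons below lose [c * K] and [(1 + h) * K] times the tolerance; the extra [1] keeps
   the denominator positive when [K = 0]. *)
have [|[f' g'] Dfg' /= [ff' gg']] := Dfg (e / ((c + 1 + h) * K + 1)).
  by rewrite divr_gt0.
set dl := e / _ in ff' gg'.
have dl0 : 0 <= dl by rewrite ltW// divr_gt0.
have h1 : c * N f <= c * N f' + c * (K * dl).
  rewrite -mulrDr ler_wpM2l//.
  by rewrite (le_trans (seminorm_dist f f'))// lerD2l ler_wpM2l// ltW.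
have h2 : N (f' - h *: g') <= N (f - h *: g) + K * ((1 + h) * dl).
  rewrite (le_trans (seminorm_dist _ (f - h *: g)))// lerD2l ler_wpM2l//.
  rewrite (_ : f' - h *: g' - (f - h *: g) = (f' - f) + h *: (g - g')); last first.
    by rewrite scalerBr opprB addrACA [RHS]addrACA [- f - _]addrC.
  rewrite (le_trans (ler_normD _ _))// mulrDl mul1r lerD//.
    by rewrite distrC ltW.
  by rewrite normrZ gtr0_norm// ler_pM2l// ltW.
have h3 := Dw _ _ Dfg' h0; rewrite -/c /= in h3.
have : ((c + 1 + h) * K + 1) * dl = e by rewrite mulrC divfK// gt_eqF.
by nra.
Qed.

End ClosureSteps.

(** * Exponential estimates by time discretisation *)

Section Semigroup.
Context {R : realType} {V : normedModType R}.
Variable S : R -> V -> V.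
Hypothesis C0 : C0_semigroup S.
Hypothesis SC : contractive S.

Let SB (t : R) f g : 0 <= t -> S t (f - g) = S t f - S t g.
Proof.
move=> t0; rewrite addrC -scaleN1r (semigroup_linear C0 t0) scaleN1r.
by rewrite addrC.
Qed.

Let SZ (t : R) c f : 0 <= t -> S t (c *: f) = c *: S t f.
Proof.
move=> t0; have S00 : S t 0 = 0 by rewrite -[in LHS](subrr f) SB// subrr.
by rewrite -[c *: f]addr0 (semigroup_linear C0 t0) S00 addr0.
Qed.

(** The continuous linear map [S t] commutes with the difference quotients, so trajectories starting
    in the domain stay in it. *)
Lemma generator_semigroup (t : R) fg : 0 <= t ->
  generator S fg -> generator S (S t fg.1, S t fg.2).
Proof.
move=> t0 Gfg; rewrite /generator /=.
have : S t (h^-1 *: (S h fg.1 - fg.1)) @[h --> 0^'+] --> S t fg.2.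
  by apply: (cvg_comp _ _ Gfg); exact: (semigroup_bounded C0 t0).
apply: cvg_trans; apply: near_eq_cvg; near=> h.
have h0 : 0 <= h by apply: ltW; near: h; exact: nbhs_right_gt.
by rewrite SZ// SB// -!(semigroupD C0)// [h + t]addrC.
Unshelve. all: by end_near.
Qed.

(** For [n] large, [t / n] is a small step that divides [t] exactly. *)
Lemma small_step (t : R) (P : R -> Prop) : 0 < t ->
  (\forall h \near 0^'+, P h) -> exists h n, [/\ 0 < h, n%:R * h = t & P h].
Proof.
move=> t0 [dl /= dl0 H].
have tn : t / dl < (Num.truncn (t / dl)).+1%:R by exact: truncnS_gt.
set n := (Num.truncn _).+1 in tn.
have tn0 : 0 < t / n%:R by rewrite divr_gt0.
exists (t / n%:R), n; split=> //; first by rewrite mulrC divfK// pnatr_eq0.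
apply: H => //; rewrite /ball_/= sub0r normrN gtr0_norm//.
by rewrite ltr_pdivrMr// mulrC -ltr_pdivrMr.
Qed.

(* An implicit Euler step of length [h] decreases [N] by the factor
   [1 + h * w] up to an error [o(h)] which, by contractivity, is uniform in
   time; hence [t / h] steps give the exponential bound as [h] tends to 0. *)
Lemma seminorm_decay_generator (N : V -> R) (K w w' : R) :
  (forall f g, N (f + g) <= N f + N g) -> (forall f, N f <= K * `|f|) ->
  (forall f, 0 <= N f) -> 0 <= K -> 0 < w' -> w' < w ->
  (forall fg h, generator S fg -> 0 < h ->
     (1 + h * w) * N fg.1 <= N (fg.1 - h *: fg.2)) ->
  forall fg t, generator S fg -> 0 <= t ->
    N (S t fg.1) <= expR (- w' * t) * N fg.1.
Proof.
move=> ND NK N0 K0 w'0 w'w dis [f g] t Gfg; rewrite le_eqVlt => /predU1P[<-|t0] /=.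
  by rewrite mulr0 expR0 mul1r (semigroup0 C0).
have w0 : 0 < w by exact: lt_trans w'w.
apply/ler_addgt0Pr => e e0.
(* Defect of an implicit Euler step: the generator is evaluated at the end point [S h f], where its
   value is [S h g]. *)
have eta0 : `|h^-1 *: (S h f - f) - S h g| @[h --> 0^'+] --> (0 : R).
  by have := cvg_norm (cvgB Gfg (@semigroup_cvg _ _ S C0 g)); rewrite subrr normr0; exact.
pose e1 := e * w / (K + 1).
have e10 : 0 < e1 by rewrite divr_gt0 ?mulr_gt0// ltr_wpDl.
(* The bound on [h * (w * w')] is what makes [(1 + h * w) * expR (- w' * h)] at least [1] in the
   induction. *)
have : \forall h \near 0^'+, `|h^-1 *: (S h f - f) - S h g| < e1 /\
    h * (w * w') < w - w'.
  near=> h; split.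
    have : `| `|h^-1 *: (S h f - f) - S h g| | < e1.
      near: h; move/cvgr0Pnorm_lt : eta0; exact.
    by rewrite normr_id.
  rewrite -ltr_pdivlMr ?mulr_gt0//; near: h; apply: nbhs_right_lt.
  by rewrite divr_gt0 ?mulr_gt0// subr_gt0.
move=> /(small_step t0)[h [n [h0 nh [h1 h2]]]].
set eta := `|_| in h1.
(* The defect at time [k * h] is the image under [S (k * h)] of the one at time [0], hence of norm
   at most [eta]. *)
have step k : (1 + h * w) * N (S (k.+1%:R * h) f) <= N (S (k%:R * h) f) + h * (K * eta).
  have kh0 : 0 <= k%:R * h by rewrite mulr_ge0// ltW.
  have k1h0 : 0 <= k.+1%:R * h by rewrite mulr_ge0// ltW.
  apply: (le_trans (dis _ _ (generator_semigroup k1h0 Gfg) h0)) => /=.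
  apply: (le_trans (seminorm_dist ND NK _ (S (k%:R * h) f))).
  rewrite lerD2l mulrCA ler_wpM2l// -natr1 mulrDl mul1r !(semigroupD C0)// ?(ltW h0)//.
  rewrite -SZ// -!SB//; apply: (le_trans (SC _ kh0)).
  rewrite /eta -[X in X * _](gtr0_norm h0) -normrZ scalerBr scalerA mulfV ?gt_eqF// scale1r.
  by rewrite addrAC lexx.
(* The constant [K * eta / w] is the fixed point of [x |-> (x + h * (K * eta)) / (1 + h * w)], so
   the accumulated error does not grow with [k]. *)
have main k : N (S (k%:R * h) f) <= expR (- w' * h) ^+ k * N f + K * eta / w.
  elim: k => [|k IH].
    rewrite mul0r (semigroup0 C0) expr0 mul1r lerDl.
    by rewrite divr_ge0 ?(ltW w0)// mulr_ge0// normr_ge0.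
  have den : 0 < 1 + h * w by rewrite ltr_wpDr// mulr_ge0// ltW.
  rewrite -(ler_pM2l den) (le_trans (step k))//.
  rewrite (le_trans (lerD IH (lexx _)))//.
  have q1 : 1 <= (1 + h * w) * expR (- w' * h).
    apply: le_trans (ler_wpM2l (ltW den) (expR_ge1Dx (- w' * h))).
    have := mulr_ge0 (ltW h0) (ltW (_ : 0 < w - w' - h * (w * w'))).
    by rewrite subr_gt0 => /(_ h2); lra.
  have -> : (1 + h * w) * (expR (- w' * h) ^+ k.+1 * N f + K * eta / w) =
    (1 + h * w) * expR (- w' * h) * (expR (- w' * h) ^+ k * N f) + (K * eta / w + h * (K * eta)).
    by rewrite exprS; field; rewrite gt_eqF.
  rewrite -addrA lerD2r ler_peMl// mulr_ge0// exprn_ge0// expR_ge0.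
have := main n; rewrite nh -expRM_natl mulrCA nh => /le_trans; apply.
rewrite lerD2l ler_pdivrMr//.
apply: (@le_trans _ _ ((K + 1) * e1)).
  by apply: ler_pM => //; [exact: normr_ge0|rewrite lerDl|exact: ltW].
by rewrite /e1 mulrC divfK// gt_eqF// ltr_wpDl.
Unshelve. all: by end_near.
Qed.

(** It suffices to check dissipativity on a core [D]: it passes to the closure, and the decay
    extends from the domain to [V] by density, as [N] is Lipschitz and [S] contractive. *)
Lemma seminorm_decay (N : V -> R) (K w w' : R) (D : set (V * V)) :
  (forall f g, N (f + g) <= N f + N g) -> (forall f, N f <= K * `|f|) ->
  (forall f, 0 <= N f) -> 0 <= K -> 0 < w' -> w' < w ->
  generator S = closure D ->
  (forall f e, 0 < e -> exists2 fg, D fg & `|f - fg.1| < e) ->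
  (forall fg h, D fg -> 0 < h ->
     (1 + h * w) * N fg.1 <= N (fg.1 - h *: fg.2)) ->
  forall f t, 0 <= t -> N (S t f) <= expR (- w' * t) * N f.
Proof.
move=> ND NK N0 K0 w'0 w'w GD dense dis f t t0.
have w0 : 0 <= w by rewrite ltW// (lt_trans w'0).
apply/ler_addgt0Pr => e e0.
have K10 : 0 < 2 * K + 1 by rewrite ltr_wpDl// mulr_ge0.
have [|fg Dfg ffg] := dense f (e / (2 * K + 1)); first by rewrite divr_gt0.
set dl := e / _ in ffg.
have Gfg : generator S fg by rewrite GD; exact: subset_closure.
have dis' fg' h : generator S fg' -> 0 < h ->
    (1 + h * w) * N fg'.1 <= N (fg'.1 - h *: fg'.2).
  by rewrite GD => Dfg' h0; exact: (dissipative_closure ND NK K0 w0 dis).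
have h1 := seminorm_decay_generator ND NK N0 K0 w'0 w'w dis' Gfg t0.
have h2 : N (S t f) <= N (S t fg.1) + K * dl.
  rewrite (le_trans (seminorm_dist ND NK _ (S t fg.1)))// lerD2l ler_wpM2l//.
  by rewrite -SB// (le_trans (SC _ t0))// ltW.
have h3 : N fg.1 <= N f + K * dl.
  rewrite (le_trans (seminorm_dist ND NK _ f))// lerD2l ler_wpM2l//.
  by rewrite distrC ltW.
have x0 := expR_ge0 (- w' * t).
have x1 : expR (- w' * t) <= 1.
  by rewrite -expR0 ler_expR mulNr oppr_le0 mulr_ge0// ltW.
have dl0 : 0 < dl by rewrite divr_gt0.
have : (2 * K + 1) * dl = e by rewrite mulrC divfK// gt_eqF.
have := ler_wpM2l x0 h3.
have Kdl : 0 <= K * dl by rewrite mulr_ge0// ltW.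
have : expR (- w' * t) * (K * dl) <= K * dl by rewrite ler_piMl.
by lra.
Qed.

(** The upper bound comes from [expR (- y) <= 1 / (1 + y) <= 1 - y + y ^+ 2]. *)
Lemma expRN_taylor1 (y : R) : 0 <= y -> `|expR (- y) - (1 - y)| <= y ^+ 2.
Proof.
move=> y0; rewrite ger0_norm; last by rewrite subr_ge0; exact: expR_ge1Dx.
have : expR (- y) * (1 + y) <= 1.
  by rewrite -[leRHS](expRxMexpNx_1 y) mulrC ler_wpM2r ?expR_ge0// expR_ge1Dx.
have := expR_ge0 (- y); have := expR_ge1Dx (- y).
rewrite expr2; nra.
Qed.

(** Over a step [h] the two sides differ by [o(h)]. As [S] is contractive and the exponential factor
    is at most [1], the errors of the [t / h] steps merely add up. *)
Lemma semigroup_eigenvector (th : R) (e : V) : 0 <= th ->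
  generator S (e, - th *: e) ->
  forall t, 0 <= t -> S t e = expR (- th * t) *: e.
Proof.
move=> th0 Ge t; rewrite le_eqVlt => /predU1P[<-|t0].
  by rewrite mulr0 expR0 scale1r (semigroup0 C0).
apply/eqP; rewrite -subr_eq0 -normr_le0; apply/ler_addgt0Pr => eps eps0.
rewrite add0r.
have e10 : 0 < eps / (2 * t) by rewrite divr_gt0// mulr_gt0.
set e1 := eps / _ in e10.
have : \forall h \near 0^'+, `|- th *: e - h^-1 *: (S h e - e)| < e1 /\
    h * (th ^+ 2 * `|e| + 1) < e1.
  near=> h; split.
    by near: h; move/cvgrPdist_lt : Ge; exact.
  rewrite -ltr_pdivlMr; last by rewrite ltr_wpDl// mulr_ge0// sqr_ge0.
  near: h; apply: nbhs_right_lt.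
  by rewrite divr_gt0// ltr_wpDl// mulr_ge0// sqr_ge0.
move=> /(small_step t0)[h [n [h0 nh [h1 h2]]]].
have h3 : `|S h e - expR (- th * h) *: e| <= h * (2 * e1).
  have -> : S h e - expR (- th * h) *: e =
      - (h *: (- th *: e - h^-1 *: (S h e - e))) - (expR (- (th * h)) - (1 - th * h)) *: e.
    rewrite mulNr scalerBr !scalerA mulfV ?gt_eqF// scale1r opprB mulrN scaleNr opprK.
    rewrite [h * th]mulrC !scalerBl scale1r opprB addrA -[S h e - e + _]addrA.
    by rewrite [- e + _]addrC -[_ *: e - e]opprB subrK.
  rewrite (le_trans (ler_normB _ _))// normrN !normrZ (gtr0_norm h0).
  rewrite mulr_natl mulrnAr mulr2n lerD ?ler_pM2l// ?(ltW h1)//.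
  rewrite (le_trans (ler_wpM2r _ (expRN_taylor1 _)))// ?mulr_ge0// ?(ltW h0)//.
  have -> : (th * h) ^+ 2 * `|e| = h * (h * (th ^+ 2 * `|e|)) by ring.
  by rewrite ler_pM2l// (le_trans _ (ltW h2))// ler_pM2l// lerDl.
have main k : `|S (k%:R * h) e - expR (- th * h) ^+ k *: e| <= k%:R * (h * (2 * e1)).
  elim: k => [|k IH].
    by rewrite !mul0r (semigroup0 C0) expr0 scale1r subrr normr0.
  have kh0 : 0 <= k%:R * h by rewrite mulr_ge0// ltW.
  rewrite -natr1 mulrDl mul1r [_ * h + h]addrC (semigroupD C0) ?(ltW h0)//.
  (* Telescoping: the previous error is propagated and the error of one new step is added. *)
  have -> : S h (S (k%:R * h) e) - expR (- th * h) ^+ k.+1 *: e =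
      S h (S (k%:R * h) e - expR (- th * h) ^+ k *: e) +
      expR (- th * h) ^+ k *: (S h e - expR (- th * h) *: e).
    rewrite SB ?SZ ?(ltW h0)// scalerBr scalerA -exprSr.
    by rewrite addrA subrK.
  rewrite (le_trans (ler_normD _ _))// mulrDl mul1r lerD//.
    by rewrite (le_trans (SC _ (ltW h0))).
  rewrite (le_trans _ h3)// normrZ ler_piMl// normrX (ger0_norm (expR_ge0 _)).
  rewrite exprn_ile1 ?expR_ge0//.
  by rewrite -expR0 ler_expR mulNr oppr_le0 mulr_ge0// ltW.
have := main n; rewrite nh -expRM_natl mulrCA nh mulrA nh => /le_trans; apply.
by rewrite mulrCA /e1 mulrA mulrC divfK// mulf_neq0// gt_eqF.
Unshelve. all: by end_near.
Qed.

End Semigroup.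

(** * Finitely supported sequences in X *)

Section WeightedSequences.
Context {R : realType}.
Implicit Types (f : R^nat) (J I : nat).

Lemma wsummable_bounded f c :
  (forall J, \sum_(n < J) n.+1%:R * `|f n| <= c) -> f \in wsummable.
Proof.
move=> fc; apply/wsummableP/nondecreasing_is_cvgn.
  by apply/nondecreasing_series => *; exact: wterm_ge0.
by exists c => _ [J _ <-]; rewrite seriesEord/= fc.
Qed.

Lemma Xnorm_le (f : X R) c :
  (forall J, \sum_(n < J) n.+1%:R * `|f n| <= c) -> `|f| <= c.
Proof.
move=> fc; apply: limr_le; first exact: Xcvg.
by near=> J; rewrite seriesEord/= fc.
Unshelve. all: by end_near. Qed.

Lemma Xnorm_ge (f : X R) J : \sum_(n < J) n.+1%:R * `|f n| <= `|f|.
Proof.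
have nd : nondecreasing_seq (series (wterm f)).
  by apply/nondecreasing_series => *; exact: wterm_ge0.
rewrite [leLHS](_ : _ = series (wterm f) J); last by rewrite seriesEord.
exact: nondecreasing_cvgn_le nd (@Xcvg _ f) J.
Qed.

Lemma sum_trunc (u : R^nat) I J :
  \sum_(n < I) (if (n < J)%N then u n else 0) = \sum_(n < minn I J) u n.
Proof.
rewrite -big_mkcond/= (big_ord_widen_cond I xpredT u (geq_minl _ _)).
by apply: eq_bigl => n; rewrite /= leq_min ltn_ord.
Qed.

Lemma ler_sum_ord (u : R^nat) I J : (forall n, 0 <= u n) -> (I <= J)%N ->
  \sum_(n < I) u n <= \sum_(n < J) u n.
Proof.
move=> u0 IJ; rewrite (big_ord_widen _ _ IJ) [leRHS](bigID (fun n : 'I_J => (n < I)%N))/=.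
by rewrite lerDl sumr_ge0.
Qed.

Definition trunc J f : R^nat := fun n => if (n < J)%N then f n else 0.

Lemma sum_trunc_le J f I :
  \sum_(n < I) n.+1%:R * `|trunc J f n| <= \sum_(n < J) n.+1%:R * `|f n|.
Proof.
rewrite (eq_bigr (fun n : 'I_I => if (n < J)%N then n.+1%:R * `|f n| else 0)).
  rewrite (sum_trunc (fun n => n.+1%:R * `|f n|)).
  by apply: (@ler_sum_ord (fun n => n.+1%:R * `|f n|)); rewrite ?geq_minr.
by move=> n _; rewrite /trunc; case: ifP; rewrite // normr0 mulr0.
Qed.

Lemma wsummable_trunc J f : trunc J f \in wsummable.
Proof. exact: wsummable_bounded (sum_trunc_le J f). Qed.

Definition truncX J f : X R := MkX (wsummable_trunc J f).

Lemma Xnorm_trunc J f : `|truncX J f| = \sum_(n < J) n.+1%:R * `|f n|.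
Proof.
apply/eqP; rewrite eq_le Xnorm_le/=; last exact: sum_trunc_le.
rewrite (le_trans _ (Xnorm_ge _ J))// ler_sum// => n _ /=.
by rewrite /trunc ltn_ord.
Qed.

Lemma XBE (f g : X R) n : (f - g) n = f n - g n. Proof. by []. Qed.

Lemma XZE c (f : X R) n : (c *: f) n = c * f n. Proof. by []. Qed.

Lemma sum_tail_le (f : X R) I J : \sum_(n < I) n.+1%:R * `|f n - trunc J f n| <=
  `|f| - \sum_(n < J) n.+1%:R * `|f n|.
Proof.
rewrite lerBrDr (le_trans _ (Xnorm_ge f (maxn I J)))//.
rewrite [leRHS](bigID (fun n : 'I_(maxn I J) => (n < J)%N))/= addrC lerD//; last first.
  by rewrite (big_ord_widen _ (fun n => n.+1%:R * `|f n|) (leq_maxr I J)).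
rewrite (le_trans (@ler_sum_ord (fun n => n.+1%:R * `|f n - trunc J f n|) _ _ _ (leq_maxl I J)))//.
rewrite (bigID (fun n : 'I_(maxn I J) => (n < J)%N))/= big1 ?add0r; last first.
  by move=> n nJ; rewrite /trunc nJ subrr normr0 mulr0.
by rewrite ler_sum// => n nJ; rewrite /trunc (negbTE nJ) subr0.
Qed.

Lemma truncX_cvg (f : X R) e : 0 < e ->
  exists J0, forall J, (J0 <= J)%N -> `|f| - \sum_(n < J) n.+1%:R * `|f n| < e.
Proof.
move=> e0; have /cvgrPdist_lt/(_ _ e0)[J0 _ H] : series (wterm f) @ \oo --> `|f|.
  exact: Xcvg.
exists J0 => J /H /=; rewrite seriesEord/=; apply: le_lt_trans.
exact: ler_norm.
Qed.

Lemma truncX_dist (f : X R) J :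
  `|f - truncX J f| <= `|f| - \sum_(n < J) n.+1%:R * `|f n|.
Proof. by apply: Xnorm_le => I; exact: sum_tail_le. Qed.

Lemma truncX_dense (f : X R) e : 0 < e -> exists J0, forall J, (J0 <= J)%N ->
  `|f - truncX J f| < e.
Proof.
move=> /(truncX_cvg f)[J0 H]; exists J0 => J /H; apply: le_lt_trans.
exact: truncX_dist.
Qed.

Lemma truncXB J f g : truncX J (f - g) = truncX J f - truncX J g.
Proof.
apply/val_inj/funext => n; rewrite [RHS]XBE/= /trunc/=.
by case: ifP => //; rewrite subr0.
Qed.

Lemma truncXZ J c f : truncX J (c *: f) = c *: truncX J f.
Proof.
apply/val_inj/funext => n; rewrite [RHS]XZE/= /trunc/=.
by case: ifP => //; rewrite mulr0.
Qed.

(** * Seminorms given by bounded weights *)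

Section Multiplier.
Variables (c : R^nat) (W : R).
Hypothesis c0 : forall n, 0 <= c n.
Hypothesis cW : forall n, c n <= W.

Lemma wsummable_mul (f : X R) : (fun n => c n * f n) \in wsummable.
Proof.
apply: (@wsummable_bounded _ (W * `|f|)) => J.
apply: le_trans (ler_wpM2l (le_trans (c0 0) (cW 0)) (Xnorm_ge f J)).
rewrite mulr_sumr ler_sum// => n _.
by rewrite normrM (ger0_norm (c0 _)) mulrCA ler_wpM2r// mulr_ge0.
Qed.

(** Through this identification the seminorm axioms are inherited from the norm of [X]. The weight
    [c] may vanish somewhere, so definiteness can fail. *)
Lemma wnorm_mulX (f : X R) : wnorm (fun n => c n * f n) = `|MkX (wsummable_mul f)|.
Proof. by []. Qed.

Lemma wnorm_mulD (f g : X R) :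
  wnorm (fun n => c n * (f + g) n) <= wnorm (fun n => c n * f n) + wnorm (fun n => c n * g n).
Proof.
rewrite !wnorm_mulX (le_trans _ (ler_normD _ _))//.
rewrite (_ : MkX _ = MkX (wsummable_mul f) + MkX (wsummable_mul g))//.
by apply/val_inj/funext => n; exact: mulrDr.
Qed.

Lemma wnorm_mul_ge0 (f : X R) : 0 <= wnorm (fun n => c n * f n).
Proof. by rewrite wnorm_mulX. Qed.

Lemma wnorm_mulE (f : X R) J :
  \sum_(n < J) n.+1%:R * (c n * `|f n|) <= wnorm (fun n => c n * f n).
Proof.
rewrite wnorm_mulX (le_trans _ (Xnorm_ge _ J))// ler_sum// => n _ /=.
by rewrite normrM (ger0_norm (c0 _)).
Qed.

Lemma wnorm_mul_trunc (f : R^nat) J :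
  wnorm (fun n => c n * truncX J f n) = \sum_(n < J) n.+1%:R * (c n * `|f n|).
Proof.
rewrite wnorm_mulX (_ : MkX _ = truncX J (fun n => c n * f n)).
  by rewrite Xnorm_trunc; apply: eq_bigr => n _; rewrite normrM (ger0_norm (c0 _)).
by apply/val_inj/funext => n /=; rewrite /trunc; case: ifP; rewrite // mulr0.
Qed.

Lemma wnorm_mul_le (f : X R) : wnorm (fun n => c n * f n) <= W * `|f|.
Proof.
rewrite wnorm_mulX Xnorm_le// => J /=.
apply: le_trans (ler_wpM2l (le_trans (c0 0) (cW 0)) (Xnorm_ge f J)).
rewrite mulr_sumr ler_sum// => n _.
by rewrite normrM (ger0_norm (c0 _)) mulrCA ler_wpM2r// mulr_ge0.
Qed.

End Multiplier.

(** * Pairing with an element of the dual *)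

Section Pairing.
Variables (es : R^nat) (K : R).
Hypothesis esK : forall n, `|es n| <= K * n.+1%:R.

Lemma pairing_bound_ge0 : 0 <= K.
Proof. by have := le_trans (normr_ge0 _) (esK 0); rewrite mulr1. Qed.

Let term_le (f : X R) n : `|es n * f n| <= K * (n.+1%:R * `|f n|).
Proof. by rewrite normrM mulrA ler_wpM2r. Qed.

Lemma Xdual_bound : Xdual es.
Proof. by exists K => _ [n _ <-]; rewrite ler_pdivrMr. Qed.

Lemma is_cvg_pairing (f : X R) : cvgn (series (fun n => es n * f n)).
Proof.
apply: normed_cvg; apply: (@series_le_cvg _ _ (K *: wterm f)) => [n|n|n|].
- exact: normr_ge0.
- by rewrite mulr_ge0 ?wterm_ge0// pairing_bound_ge0.
- exact: term_le.
- exact/is_cvg_seriesZ/Xcvg.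
Qed.

Lemma pairingB (f g : X R) : pairing es (f - g) = pairing es f - pairing es g.
Proof.
rewrite /pairing -lim_seriesB; [|exact: is_cvg_pairing..].
by congr (limn (series _)); apply/funext => n /=; rewrite -mulrBr.
Qed.

Lemma pairingD (f g : X R) : pairing es (f + g) = pairing es f + pairing es g.
Proof.
rewrite /pairing -lim_seriesD; [|exact: is_cvg_pairing..].
by congr (limn (series _)); apply/funext => n /=; rewrite -mulrDr.
Qed.

Lemma pairingZ c (f : X R) : pairing es (c *: f) = c * pairing es f.
Proof.
rewrite /pairing -[RHS](lim_seriesZ c); last exact: is_cvg_pairing.
by congr (limn (series _)); apply/funext => n /=; rewrite [RHS]mulrCA.
Qed.

Lemma pairing_trunc (f : R^nat) J :
  pairing es (truncX J f) = \sum_(n < J) es n * f n.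
Proof.
apply/cvg_lim => //; apply: cvg_near_cst; near=> I.
rewrite seriesEord/= (eq_bigr (fun n : 'I_I => if (n < J)%N then es n * f n else 0)).
  rewrite (sum_trunc (fun n => es n * f n)); suff -> : minn I J = J by [].
  by apply/minn_idPr; near: I; exact: nbhs_infty_ge.
by move=> n _; rewrite /trunc; case: ifP; rewrite // mulr0.
Unshelve. all: by end_near. Qed.

Lemma pairing_le (f : X R) : `|pairing es f| <= K * `|f|.
Proof.
have H n : `|series (fun n => es n * f n) n| <= K * `|f|.
  rewrite seriesEord/= (le_trans (ler_norm_sum _ _ _))//.
  apply: le_trans (ler_wpM2l pairing_bound_ge0 (Xnorm_ge f n)).
  by rewrite mulr_sumr ler_sum// => i _; exact: term_le.
rewrite ler_norml; apply/andP; split.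
  apply: limr_ge; first exact: is_cvg_pairing.
  by near=> n; have := H n; rewrite ler_norml => /andP[].
apply: limr_le; first exact: is_cvg_pairing.
by near=> n; have := H n; rewrite ler_norml => /andP[].
Unshelve. all: by end_near. Qed.

End Pairing.

End WeightedSequences.

(** * Upper triangular matrices with dominant diagonal *)

Lemma strong_recursion (T : Type) (x0 : T) (Phi : nat -> (nat -> T) -> T) :
  (forall n u v, (forall k, (k < n)%N -> u k = v k) -> Phi n u = Phi n v) ->
  exists u, forall n, u n = Phi n u.
Proof.
move=> Phi_ext.
(* [F n] tabulates the values at indices below [n]; its other entries are arbitrary, which [Phi_ext]
   makes harmless. *)
pose F := fix F n : nat -> T :=
  if n is k.+1 then fun i => if (i < k)%N then F k i else Phi k (F k)
  else fun=> x0.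
have FE n i : (i < n)%N -> F n i = F i.+1 i.
  elim: n i => // n IH i; rewrite ltnS leq_eqVlt => /predU1P[->//|lin].
  by rewrite /= lin IH//= ltnn.
exists (fun n => F n.+1 n) => n; rewrite /= ltnn.
by apply: Phi_ext => k kn; rewrite FE.
Qed.

Section TriangularMatrix.
Context {R : realType}.
Variables (q : nat -> nat -> R) (s theta : R^nat) (m : nat) (eps : R).
Hypothesis q_ge0 : forall i j, 0 <= q i j.
Hypothesis q_tri : forall i j, (j <= i)%N -> q i j = 0.
Hypothesis q_col : forall j, \sum_(i < j) i.+1%:R * q i j <= j.+1%:R * s j.
Hypothesis s_ge0 : forall j, 0 <= s j.
Hypothesis theta_s : forall A, exists N, forall n, (N <= n)%N -> A <= theta n - s n.
Hypothesis eps_gt0 : 0 < eps.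
Hypothesis gap : forall n, n != m -> theta m + 2 * eps <= theta n.

Lemma col_sum_widen (u : R^nat) j J : (j <= J)%N ->
  \sum_(i < J) u i * q i j = \sum_(i < j) u i * q i j.
Proof.
move=> jJ; rewrite (big_ord_widen _ (fun i => u i * q i j) jJ).
rewrite [LHS](bigID (fun i : 'I_J => (i < j)%N))/= [X in _ + X]big1 ?addr0// => i.
by rewrite -leqNgt => ji; rewrite q_tri// mulr0.
Qed.

Lemma col_sum_le (u : R^nat) (c : R) j : (forall i, (i < j)%N -> u i <= c) ->
  \sum_(i < j) i.+1%:R * u i * q i j <= Num.max 0 c * (j.+1%:R * s j).
Proof.
move=> uc; apply: le_trans (ler_wpM2l _ (q_col j)); last by rewrite le_max lexx.
rewrite mulr_sumr ler_sum// => i _.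
rewrite [_ * u i]mulrC -mulrA ler_wpM2r// ?mulr_ge0//.
by rewrite le_max uc ?orbT.
Qed.

(* The factor [rho ^+ minn n N] is taken geometric with a large ratio on the
   finitely many indices where the diagonal does not yet dominate. *)
Lemma exists_weight (kap : R) : 0 <= kap ->
  exists (p : R^nat) (W : R), [/\ forall n, 1 <= p n, forall n, p n <= W &
    forall n, n != m ->
    \sum_(i < n) i.+1%:R * p i * q i n +
      (m < n)%:R * (kap * n.+1%:R * \sum_(i < m) i.+1%:R * p i * q i m)
    <= (theta n - (theta m + eps)) * (n.+1%:R * p n)].
Proof.
(* [kap'] bounds the additional term, which comes from column [m], relative to [n.+1%:R * p m]. *)
move=> kap0; pose kap' := kap * (m.+1%:R * s m).
have kap'0 : 0 <= kap' by rewrite !mulr_ge0.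
have [N0 HN0] := theta_s (theta m + eps + kap').
(* Beyond [N] the diagonal dominates, and [m <= N] puts column [m] in the geometric range. *)
pose N := maxn N0 m; have mN : (m <= N)%N by rewrite leq_maxr.
have HN n : (N < n)%N -> theta m + eps + kap' <= theta n - s n.
  by move=> Nn; apply: HN0; rewrite (leq_trans (leq_maxl N0 m))// ltnW.
(* With this ratio [rho * eps] is at least [s n + kap'] for all [n <= N] at once. *)
pose rho := 1 + (\sum_(n < N.+1) s n + kap') / eps.
have rho1 : 1 <= rho by rewrite lerDl divr_ge0 ?(ltW eps_gt0)// addr_ge0// sumr_ge0.
have rho0 : 0 < rho by rewrite (lt_le_trans _ rho1).
have rhoN n : (n <= N)%N -> s n + kap' <= rho * eps.
  move=> nN; rewrite mulrDl mul1r divfK ?gt_eqF//.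
  rewrite (bigD1 (Ordinal (nN : (n < N.+1)%N)))//= -[leLHS]add0r lerD ?(ltW eps_gt0)//.
  by rewrite lerD// lerDl sumr_ge0.
pose p n := rho ^+ minn n N.
have p0 n : 0 < p n by rewrite exprn_gt0.
have pmono i j : (i <= j)%N -> p i <= p j.
  move=> ij; rewrite ler_weXn2l// leq_min geq_minr andbT.
  by rewrite (leq_trans (geq_minl _ _)).
have col1 n : \sum_(i < n) i.+1%:R * p i * q i n <= p n * (n.+1%:R * s n).
  have := @col_sum_le p (p n) n; rewrite max_r ?(ltW (p0 n))//; apply => i /ltnW.
  exact: pmono.
(* For [i < n <= N] one has [rho * p i <= p n], which gains a factor [rho] over [col1]. *)
have col2 n : (n <= N)%N ->
    rho * \sum_(i < n) i.+1%:R * p i * q i n <= p n * (n.+1%:R * s n).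
  move=> nN; have := @col_sum_le (fun i => rho * p i) (p n) n.
  rewrite max_r ?(ltW (p0 n))// mulr_sumr => H.
  rewrite (eq_bigr (fun i : 'I_n => i.+1%:R * (rho * p i) * q i n)); last by move=> *; ring.
  apply: H => i ltin; rewrite /p -exprS ler_weXn2l// (minn_idPl nN).
  by rewrite (leq_ltn_trans (geq_minl _ _)).
exists p, (rho ^+ N); split=> [n|n|n nm].
- by rewrite exprn_ege1.
- by rewrite ler_weXn2l// geq_minr.
set cn := \sum_(i < n) _; set cm := \sum_(i < m) _.
have cm0 : 0 <= cm by rewrite sumr_ge0// => i _; rewrite !mulr_ge0// ltW.
have gapn := gap nm.
have kn0 : 0 <= kap * n.+1%:R by rewrite mulr_ge0.
have [nN|Nn] := leqP n N.
  rewrite -(ler_pM2l rho0) mulrDr.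
  have B : rho * ((m < n)%:R * (kap * n.+1%:R * cm)) <= p n * n.+1%:R * kap'.
    have [mn|_] := ltnP m n; last first.
      by rewrite mul0r mulr0 !mulr_ge0// ltW.
    rewrite mul1r (_ : _ * _ = kap * n.+1%:R * (rho * cm)); last by ring.
    rewrite (le_trans (ler_wpM2l kn0 (col2 _ mN)))//.
    rewrite [leLHS](_ : _ = p m * (n.+1%:R * kap')); last by rewrite /kap'; ring.
    by rewrite -mulrA ler_wpM2r// ?pmono ?(ltnW mn)// mulr_ge0.
  rewrite (le_trans (lerD (col2 _ nN) B))//.
  rewrite [leLHS](_ : _ = (s n + kap') * (n.+1%:R * p n)); last by ring.
  rewrite [leRHS]mulrA ler_wpM2r//; first by rewrite mulr_ge0// ltW.
  rewrite (le_trans (rhoN _ nN))// ler_pM2l//; lra.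
(* Above [N] the weight is constant, and the size of [theta n - s n] absorbs both terms. *)
have B : (m < n)%:R * (kap * n.+1%:R * cm) <= p n * n.+1%:R * kap'.
  rewrite (leq_ltn_trans mN Nn) mul1r (le_trans (ler_wpM2l kn0 (col1 m)))//.
  rewrite [leLHS](_ : _ = p m * (n.+1%:R * kap')); last by rewrite /kap'; ring.
  rewrite -mulrA ler_wpM2r// ?pmono ?(leq_trans mN (ltnW Nn))// mulr_ge0//.
rewrite (le_trans (lerD (col1 _) B))//.
rewrite [leLHS](_ : _ = (s n + kap') * (n.+1%:R * p n)); last by ring.
rewrite ler_wpM2r//; first by rewrite mulr_ge0// ltW.
by have := HN _ Nn; lra.
Qed.

(** Column [n] of the eigenvalue equation expresses [es n] through smaller indices, with divisor
    [theta n - theta m], positive off [m]; so it is solved upwards from [m]. *)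
Lemma left_eigenvector : exists (es : R^nat) (K : R),
  [/\ es m = 1, forall n, (n < m)%N -> es n = 0,
      forall n, 0 <= es n, forall n, es n <= K * n.+1%:R &
      forall n, \sum_(i < n) es i * q i n = (theta n - theta m) * es n].
Proof.
pose Phi n u : R := if (n < m)%N then 0 else if n == m then 1 else
  (\sum_(i < n) u i * q i n) / (theta n - theta m).
have [n u v uv|es esE] := @strong_recursion R 0 Phi.
  by rewrite /Phi; under eq_bigr do rewrite uv//.
have dth n : n != m -> 0 < theta n - theta m by move=> /gap; move: eps_gt0; lra.
have es0 n : (n < m)%N -> es n = 0 by move=> nm; rewrite esE /Phi nm.
have esm : es m = 1 by rewrite esE /Phi ltnn eqxx.
have esig n : \sum_(i < n) es i * q i n = (theta n - theta m) * es n.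
  have [nm|mn|->] := ltngtP n m.
  - rewrite es0// mulr0 big1// => i _; rewrite es0 ?mul0r//.
    exact: ltn_trans nm.
  - have nm : n != m by rewrite gtn_eqF.
    by rewrite [in RHS]esE /Phi ltnNge (ltnW mn) (negbTE nm) /= mulrC divfK// gt_eqF// dth.
  - by rewrite subrr mul0r big1// => i _; rewrite es0 ?mul0r.
(* With [kap = 0], the sequence [n.+1%:R * p n] is a supersolution of the recursion for [es];
   comparison by induction gives the growth bound. *)
have [p [W [p1 pW pP]]] := exists_weight (lexx 0).
have pge0 n : 0 <= n.+1%:R * p n by rewrite mulr_ge0// (le_trans _ (p1 n)).
have es_bd n : 0 <= es n <= n.+1%:R * p n.
  have [k] := ubnP n; elim: k n => // k IH n nk.
  have [nm|mn|->] := ltngtP n m.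
  - by rewrite es0// lexx pge0.
  - have nm : n != m by rewrite gtn_eqF.
    have IH' i : (i < n)%N -> 0 <= es i <= i.+1%:R * p i.
      by move=> ltin; apply: IH; exact: leq_trans ltin _.
    have := esig n => En; apply/andP; split.
      rewrite -(pmulr_rge0 _ (dth _ nm)) -En sumr_ge0// => i _.
      by rewrite mulr_ge0//; have /andP[] := IH' i (ltn_ord i).
    rewrite -(ler_pM2l (dth _ nm)) -En.
    have := pP n nm; rewrite !mul0r mulr0 addr0 => H.
    apply: (@le_trans _ _ (\sum_(i < n) i.+1%:R * p i * q i n)).
      by rewrite ler_sum// => i _; rewrite ler_wpM2r//; have /andP[] := IH' i (ltn_ord i).
    apply: (le_trans H); rewrite ler_wpM2r//; move: eps_gt0; lra.
  - by rewrite esm ler01 mulr_ege1// ler1n.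
exists es, W; split => // n; have /andP[//] := es_bd n.
by move=> _ /le_trans; apply; rewrite mulrC ler_wpM2r.
Qed.

(** Row [i] involves only coordinates above [i], so the equation is solved downwards from [m]. In
    the recursion, index [k] stands for coordinate [m - k]. *)
Lemma right_eigenvector : exists e : R^nat,
  [/\ e m = 1, forall i, (m < i)%N -> e i = 0 &
      forall i, \sum_(j < m.+1) q i j * e j = (theta i - theta m) * e i].
Proof.
pose Phi k u : R := if k == 0%N then 1 else
  (\sum_(l < k) q (m - k)%N (m - l)%N * u l) / (theta (m - k)%N - theta m).
have [n u v uv|v vE] := @strong_recursion R 0 Phi.
  by rewrite /Phi; under eq_bigr do rewrite uv//.
exists (fun i => if (i <= m)%N then v (m - i)%N else 0); split.
- by rewrite leqnn subnn vE.
- by move=> i mi; rewrite leqNgt mi.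
move=> i; have [im|mi] := leqP i m; last first.
  by rewrite mulr0 big1// => j _; rewrite q_tri ?mul0r// (leq_trans (leq_ord j))// ltnW.
have {im} [k km ->] : exists2 k, (k <= m)%N & i = (m - k)%N.
  by exists (m - i)%N; rewrite ?leq_subr// subKn.
rewrite subKn// (reindex_inj rev_ord_inj)/=.
rewrite (eq_bigr (fun l : 'I_m.+1 => q (m - k)%N (m - l)%N * v l)); last first.
  by move=> l _; rewrite subSS leq_subr subKn// leq_ord.
rewrite (bigID (fun l : 'I_m.+1 => (l < k)%N))/= [X in _ + X]big1 ?addr0; last first.
  by move=> l; rewrite -leqNgt => kl; rewrite q_tri ?mul0r// leq_sub2l.
rewrite -(big_ord_widen _ (fun l => q (m - k)%N (m - l)%N * v l)); last exact: leqW.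
have [->|k0] := eqVneq k 0%N; first by rewrite big_ord0 subn0 subrr mul0r.
rewrite [in RHS]vE /Phi (negbTE k0) mulrC divfK// gt_eqF//.
have : (m - k)%N != m by rewrite ltn_eqF// ltn_subrL lt0n k0 (leq_trans _ km)// lt0n.
by move=> /gap; move: eps_gt0; lra.
Qed.

(** Only the sum is cut at [J], not the rows: on sequences supported below [J] this is the full
    matrix, [q] minus the diagonal [theta]. *)
Definition mx_apply J (f : R^nat) : R^nat :=
  fun i => \sum_(j < J) q i j * f j - theta i * f i.

(** By triangularity, columns below [J] live in rows below [J], so cutting the sums at [J] leaves no
    boundary term. *)
Lemma left_eigenvector_apply (es : R^nat) J (f : R^nat) :
  (forall n, \sum_(i < n) es i * q i n = (theta n - theta m) * es n) ->
  \sum_(i < J) es i * mx_apply J f i = - theta m * \sum_(i < J) es i * f i.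
Proof.
move=> esig; rewrite (eq_bigr (fun i : 'I_J => \sum_(j < J) (es i * q i j) * f j -
  theta i * (es i * f i))); last first.
  move=> i _; rewrite /mx_apply mulrBr mulr_sumr mulrCA; congr (_ - _).
  by apply: eq_bigr => j _; rewrite mulrA.
rewrite big_split/= exchange_big/= mulr_sumr -big_split/=.
apply: eq_bigr => j _; rewrite -mulr_suml col_sum_widen ?esig; [ring|exact: ltnW (ltn_ord j)].
Qed.

(* On [ker es] the coordinate [m] is controlled by the coordinates above it,
   so that the norm of the remaining coordinates decreases at a rate larger
   than [theta m]. *)
Lemma dissipative_off_eigenvalue (es p c : R^nat) (K : R) J (f : R^nat) (h : R) :
  es m = 1 -> (forall n, (n < m)%N -> es n = 0) ->
  (forall n, 0 <= es n) -> (forall n, es n <= K * n.+1%:R) ->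
  (forall n, 1 <= p n) ->
  (forall n, n != m ->
    \sum_(i < n) i.+1%:R * p i * q i n +
      (m < n)%:R * (K * n.+1%:R * \sum_(i < m) i.+1%:R * p i * q i m)
    <= (theta n - (theta m + eps)) * (n.+1%:R * p n)) ->
  (m < J)%N -> 0 < h -> (forall n, 0 <= theta n) ->
  \sum_(n < J) es n * f n = 0 ->
  c m = 0 -> (forall n, n != m -> c n = p n) ->
  (1 + h * (theta m + eps)) * \sum_(n < J) n.+1%:R * (c n * `|f n|) <=
  \sum_(n < J) n.+1%:R * (c n * `|f n - h * mx_apply J f n|).
Proof.
move=> esm es0 es_ge0 esK p1 pP mJ h0 th0 Ff cm0E cpE.
have p0 n : 0 <= p n by rewrite (le_trans _ (p1 n)).
have c0 n : 0 <= c n by have [->|/cpE->] := eqVneq n m; rewrite ?cm0E.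
have cp n : c n <= p n by have [->|/cpE->] := eqVneq n m; rewrite ?cm0E.
set om := theta m + eps.
set cm := \sum_(i < m) i.+1%:R * p i * q i m in pP.
have cm0 : 0 <= cm by rewrite sumr_ge0// => i _; rewrite !mulr_ge0.
pose mo : 'I_J := Ordinal mJ.
have fm : `|f m| <= \sum_(n < J | n != mo) es n * `|f n|.
  move: Ff; rewrite (bigD1 mo)//= esm mul1r => /eqP; rewrite addr_eq0 => /eqP ->.
  rewrite normrN (le_trans (ler_norm_sum _ _ _))// ler_sum// => n _.
  by rewrite normrM ger0_norm.
have key : \sum_(i < J) i.+1%:R * c i * \sum_(j < J) q i j * `|f j| <=
    \sum_(i < J) i.+1%:R * c i * ((theta i - om) * `|f i|).
  rewrite (eq_bigr (fun i : 'I_J => \sum_(j < J) (i.+1%:R * c i * q i j) * `|f j|)); last first.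
    by move=> i _; rewrite mulr_sumr; apply: eq_bigr => j _; rewrite mulrA.
  rewrite exchange_big/=.
  rewrite (eq_bigr (fun j : 'I_J => (\sum_(i < j) i.+1%:R * c i * q i j) * `|f j|)); last first.
    move=> j _; rewrite -mulr_suml; congr (_ * _).
    exact: (col_sum_widen (fun i => i.+1%:R * c i) (ltnW (ltn_ord j))).
  (* Coordinate [m] has weight zero on the right, yet column [m] feeds the rows before [m]; [fm]
     redistributes this contribution over the other columns, where [pP] has room for it. *)
  rewrite (bigD1 mo)//= [leRHS](bigD1 mo)//= cm0E mulr0 mul0r add0r.
  rewrite (_ : \sum_(i < m) _ = cm); last first.
    by apply: eq_bigr => i _; rewrite cpE// ltn_eqF.
  rewrite (le_trans (lerD (ler_wpM2l cm0 fm) (lexx _)))//.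
  rewrite mulr_sumr -big_split/= ler_sum// => j jm.
  have {}jm : (j : nat) != m by [].
  rewrite [_ * (es j * _)]mulrA -mulrDl [leRHS]mulrA ler_wpM2r// cpE// [leRHS]mulrC.
  apply: le_trans (pP _ jm); rewrite addrC lerD//.
    by rewrite ler_sum// => i _; rewrite ler_wpM2r// ler_wpM2l.
  have [mj|jlem] := ltnP m j; first by rewrite mul1r mulrC ler_wpM2r.
  by rewrite es0 ?mulr0 ?mul0r// ltn_neqAle jm.
(* Reverse triangle inequality, separating the nonnegative diagonal factor [1 + h * theta i] from
   the off-diagonal sum. *)
have low : \sum_(i < J) i.+1%:R * c i *
      ((1 + h * theta i) * `|f i| - h * \sum_(j < J) q i j * `|f j|) <=
    \sum_(n < J) n.+1%:R * (c n * `|f n - h * mx_apply J f n|).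
  rewrite ler_sum// => i _; rewrite mulrA ler_wpM2l ?mulr_ge0//.
  rewrite (_ : _ - _ * mx_apply _ _ _ =
    (1 + h * theta i) * f i - h * \sum_(j < J) q i j * f j); last first.
    by rewrite /mx_apply; ring.
  have t0 : 0 <= 1 + h * theta i by rewrite addr_ge0// mulr_ge0// ltW.
  rewrite (le_trans _ (lerB_dist _ _))// !normrM (ger0_norm t0) (gtr0_norm h0) lerB//.
  rewrite ler_pM2l// (le_trans (ler_norm_sum _ _ _))// ler_sum// => j _.
  by rewrite normrM ger0_norm.
apply: le_trans low.
rewrite [leRHS](eq_bigr (fun i : 'I_J => (i.+1%:R * c i * `|f i|
   + h * (i.+1%:R * c i * (theta i * `|f i|)))
   - h * (i.+1%:R * c i * \sum_(j < J) q i j * `|f j|))); last by move=> *; ring.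
rewrite sumrB -[X in _ <= _ - X]mulr_sumr.
apply: le_trans (lerB (lexx _) (ler_wpM2l (ltW h0) key)).
rewrite !mulr_sumr -sumrB ler_sum// => i _.
by rewrite le_eqVlt; apply/orP; left; apply/eqP; ring.
Qed.

End TriangularMatrix.

(** * The decay-fragmentation matrix *)

Section FragmentationMatrix.
Context {R : realType}.
Variables (r d a : R^nat) (b : nat -> R^nat).
Hypothesis coefs : decay_fragmentation_coefficients r d a b.

(** The off-diagonal part of A + B: decay on the superdiagonal plus fragmentation. Together with
    [frag_rate] it instantiates the triangular setting above, where the difference of [theta] and
    [frag_rate] is the death rate [d]. *)
Definition frag_mx (i j : nat) : R := (j == i.+1)%:R * r j + a j * b i j.

Definition frag_rate (j : nat) : R := r j + a j.

Lemma frag_ge0 j : 0 <= a j.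
Proof. by case: j => [|j]; [rewrite (frag_first coefs)|rewrite ltW// (frag_gt0 coefs)]. Qed.

Lemma frag_mx_ge0 i j : 0 <= frag_mx i j.
Proof.
by rewrite addr_ge0 ?mulr_ge0 ?frag_ge0 ?(daughter_ge0 coefs)// ltW// (decay_gt0 coefs).
Qed.

Lemma frag_mx_tri i j : (j <= i)%N -> frag_mx i j = 0.
Proof.
by move=> ji; rewrite /frag_mx ltn_eqF ?ltnS// (daughter_eq0 coefs)// mul0r mulr0 addr0.
Qed.

Lemma frag_rate_ge0 j : 0 <= frag_rate j.
Proof. by rewrite addr_ge0 ?frag_ge0// ltW// (decay_gt0 coefs). Qed.

Lemma theta_ge0 j : 0 <= theta r d a j.
Proof. by rewrite addr_ge0 ?frag_rate_ge0// (death_ge0 coefs). Qed.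

Lemma frag_rate_le_theta j : frag_rate j <= theta r d a j.
Proof. by rewrite lerDl (death_ge0 coefs). Qed.

(** Decay lowers the mass of a particle by one unit and fragmentation conserves mass, so neither
    creates mass. *)
Lemma frag_mx_col j : \sum_(i < j) i.+1%:R * frag_mx i j <= j.+1%:R * frag_rate j.
Proof.
case: j => [|j].
  by rewrite big_ord0 mulr_ge0// frag_rate_ge0.
rewrite (eq_bigr (fun i : 'I_j.+1 => (j == i)%:R * (i.+1%:R * r j.+1) +
    a j.+1 * (i.+1%:R * b i j.+1))); last first.
  by move=> i _; rewrite /frag_mx eqSS; ring.
rewrite big_split/= -mulr_sumr (daughter_mass coefs)//.
rewrite big_ord_recr/= eqxx mul1r big1 ?add0r; last first.
  by move=> i _; rewrite gtn_eqF ?mul0r// ltn_ord.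
rewrite [leRHS](_ : _ = j.+2%:R * r j.+1 + a j.+1 * j.+2%:R); last by rewrite /frag_rate; ring.
rewrite lerD2r ler_wpM2r ?ler_nat//.
by rewrite ltW// (decay_gt0 coefs).
Qed.

Lemma daughter_le i j : b i j <= j.+1%:R.
Proof.
have [ij|ji] := ltnP i j; last by rewrite (daughter_eq0 coefs).
have j0 : (0 < j)%N by rewrite (leq_ltn_trans _ ij).
rewrite -(daughter_mass coefs j0) (bigD1 (Ordinal ij))//= -[leLHS]addr0 lerD//.
  by rewrite ler_peMl ?(daughter_ge0 coefs)// ler1n.
by rewrite sumr_ge0// => k _; rewrite mulr_ge0// (daughter_ge0 coefs).
Qed.

Lemma sum_frag_mx (f : R^nat) i n : \sum_(j < n) frag_mx i j * f j =
  (i.+1 < n)%:R * (r i.+1 * f i.+1) + \sum_(j < n) a j * b i j * f j.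
Proof.
under eq_bigr do rewrite mulrDl.
rewrite big_split/=; congr (_ + _).
have [lin|nli] := ltnP i.+1 n.
  rewrite (bigD1 (Ordinal lin))//= eqxx big1 ?addr0 ?mul1r// => j ji.
  by rewrite (_ : (_ == _) = false) ?mul0r//; exact/negbTE.
by rewrite mul0r big1// => j _; rewrite ltn_eqF ?mul0r// (leq_trans _ nli).
Qed.

(** The series in [Bop] starts at [i.+1]; the entries of [b i] up to [i] vanish, so the partial sums
    are merely shifted. *)
Lemma BopE (f : R^nat) i l :
  \sum_(j < n) a j * b i j * f j @[n --> \oo] --> l -> Bop a b f i = l.
Proof.
rewrite -(cvg_shiftn i.+1) => fl; apply/cvg_lim => //.
apply: cvg_trans fl; apply: near_eq_cvg; near=> n.
rewrite seriesEnat/= -(big_mkord xpredT (fun j => a j * b i j * f j)).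
rewrite (@big_cat_nat _ _ _ i.+1)//= ?leq_addl// big_nat big1 ?add0r; last first.
  by move=> j /andP[_]; rewrite ltnS => ji; rewrite (daughter_eq0 coefs)// mulr0 mul0r.
rewrite -{1}[i.+1]add0n big_addn addnK.
by apply: eq_bigr => j _; rewrite addnC.
Unshelve. all: by end_near. Qed.

(** The rows converge absolutely: [b i j] is at most [j.+1%:R], [a] is at most [prate], and [prate]
    times [fg.1] is summable with weight [j.+1%:R]. *)
Lemma graphAB_cvg (fg : X R * X R) i : graphAB r d a b fg ->
  \sum_(j < n) frag_mx i j * fg.1 j @[n --> \oo] --> fg.2 i + theta r d a i * fg.1 i.
Proof.
case: fg => f g [/= [pf _ _] ->].
have cvgB : cvgn (series (fun j => a j * b i j * f j)).
  apply: normed_cvg; move/wsummableP : pf; apply: series_le_cvg => j.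
  - exact: normr_ge0.
  - exact: wterm_ge0.
  rewrite /wterm /= !normrM mulrA ler_wpM2r// (ger0_norm (frag_ge0 j)).
  rewrite (ger0_norm (daughter_ge0 coefs _ _)) mulrC.
  rewrite ger0_norm ?addr_ge0 ?frag_ge0 ?(death_ge0 coefs)//.
  by rewrite ler_pM ?(daughter_ge0 coefs) ?frag_ge0 ?daughter_le// lerDl (death_ge0 coefs).
rewrite seriesEord in cvgB.
rewrite (BopE cvgB) /Aop addrAC subrK.
apply: (@cvg_trans _ ((fun n => r i.+1 * f i.+1 + \sum_(j < n) a j * b i j * f j) @ \oo)).
  apply: near_eq_cvg; near=> n; rewrite sum_frag_mx.
  by rewrite (_ : (i.+1 < n)%N) ?mul1r//; near: n; exact: nbhs_infty_gt.
by apply: cvgD; [exact: cvg_cst|exact: cvgB].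
Unshelve. all: by end_near. Qed.

Lemma mx_apply_trunc (f : R^nat) J :
  mx_apply frag_mx (theta r d a) J (trunc J f) = trunc J (mx_apply frag_mx (theta r d a) J f).
Proof.
apply/funext => i; rewrite {2}/trunc /mx_apply.
rewrite (eq_bigr (fun j : 'I_J => frag_mx i j * f j)); last first.
  by move=> j _; rewrite /trunc ltn_ord.
rewrite /trunc; case: ltnP => // Ji; rewrite mulr0 subr0 big1// => j _.
by rewrite frag_mx_tri ?mul0r// (leq_trans (ltnW (ltn_ord j))).
Qed.

Lemma graphAB_trunc (f : R^nat) J :
  graphAB r d a b (truncX J f, truncX J (mx_apply frag_mx (theta r d a) J f)).
Proof.
split=> /=.
  split.
  - rewrite (_ : (fun n => _) = trunc J (fun n => prate d a n * f n)); first exact: wsummable_trunc.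
    by apply/funext => n /=; rewrite /trunc; case: ifP; rewrite // mulr0.
  - rewrite (_ : triangle _ = trunc J.+1 (triangle (fun n => r n * trunc J f n))).
      exact: wsummable_trunc.
    apply/funext => -[|n]; rewrite /trunc//= ltnS; case: (ltnP n J) => [nJ|Jn]; rewrite /trunc.
      by rewrite nJ.
    by rewrite !ltnNge Jn (leqW Jn)/= !mulr0 subrr.
  - apply: cvg_near_cst; near=> n; rewrite /= /trunc ltnNge.
    by rewrite (_ : (J <= n)%N) ?mulr0//; near: n; exact: nbhs_infty_ge.
move=> i; rewrite -mx_apply_trunc.
have -> : Bop a b (trunc J f) i = \sum_(j < J) a j * b i j * trunc J f j.
  apply: BopE; apply: cvg_near_cst; near=> n.
  have Jn : (J <= n)%N by near: n; exact: nbhs_infty_ge.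
  rewrite (big_ord_widen _ (fun j => a j * b i j * trunc J f j) Jn).
  rewrite (bigID (fun j : 'I_n => (j < J)%N))/= [X in _ + X]big1 ?addr0// => j.
  by rewrite /trunc => /negbTE ->; rewrite mulr0.
rewrite /mx_apply sum_frag_mx /Aop [RHS]addrAC; congr (_ + _ + _).
by rewrite /= /trunc; case: (ltnP i.+1 J); rewrite ?mul1r// mul0r mulr0.
Unshelve. all: by end_near. Qed.

(** Exchanging the sums reduces this to [frag_mx_col]. It bounds the off-diagonal part by the
    diagonal part, and so controls truncation errors. *)
Lemma frag_mx_row_sum_le (f : R^nat) I n :
  \sum_(i < I) i.+1%:R * `|\sum_(j < n) frag_mx i j * f j| <=
  \sum_(j < n) j.+1%:R * `|theta r d a j * f j|.
Proof.
apply: (@le_trans _ _ (\sum_(i < I) \sum_(j < n) (i.+1%:R * frag_mx i j) * `|f j|)).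
  rewrite ler_sum// => i _.
  rewrite [leRHS](eq_bigr (fun j : 'I_n => i.+1%:R * (frag_mx i j * `|f j|))); last first.
    by move=> j _; rewrite mulrA.
  rewrite -mulr_sumr ler_wpM2l// (le_trans (ler_norm_sum _ _ _))// ler_sum// => j _.
  by rewrite normrM ger0_norm ?frag_mx_ge0.
rewrite exchange_big/= ler_sum// => j _.
rewrite -mulr_suml normrM (ger0_norm (theta_ge0 j)) mulrA ler_wpM2r//.
apply: (@le_trans _ _ (\sum_(i < maxn I j) i.+1%:R * frag_mx i j)).
  apply: (@ler_sum_ord _ (fun i => i.+1%:R * frag_mx i j)); rewrite ?leq_maxl// => i.
  by rewrite mulr_ge0 ?frag_mx_ge0.
rewrite (col_sum_widen frag_mx_tri (fun i => i.+1%:R)) ?leq_maxr//.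
rewrite (le_trans (frag_mx_col j))// ler_wpM2l//; exact: frag_rate_le_theta.
Qed.

(** * Finitely supported sequences form a core *)

Hypothesis theta_prate : exists C : R, forall n, theta r d a n <= C * prate d a n.

Lemma theta_wsummable (f : X R) : domA r d a f ->
  (fun n => theta r d a n * f n) \in wsummable.
Proof.
case=> pf _ _; have [C HC] := theta_prate.
have : (C \*: (fun n => prate d a n * f n) : R^nat) \in wsummable by exact: rpredZ.
move=> /wsummableP cf; apply/wsummableP; move: cf.
apply: series_le_cvg => n; try exact: wterm_ge0.
rewrite ler_wpM2l// /= [_ *: _]mulrA !normrM ler_wpM2r// (ger0_norm (theta_ge0 n)).
by rewrite (le_trans (HC n))// -normrM ler_norm.
Qed.

(** The condition [m < J] ensures that subtracting a multiple of an eigenvector supported in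
    [[0, m]] commutes with truncation at [J]. *)
Definition core_graph (m : nat) : set (X R * X R) :=
  [set fg | exists J f, [/\ (m < J)%N, fg.1 = truncX J f &
     fg.2 = truncX J (mx_apply frag_mx (theta r d a) J f)]].

(** Truncations converge in the graph norm: the error on the image is at most twice the tail of
    [theta] times [f], once for the diagonal and once for the off-diagonal part. *)
Lemma graphAB_core m fg : graphAB r d a b fg -> closure (core_graph m) fg.
Proof.
case: fg => f g Gfg; apply/closure_pairP => e e0.
pose psi : X R := MkX (theta_wsummable Gfg.1).
have [J1 HJ1] := truncX_dense f e0.
have e20 : 0 < e / 2 by rewrite divr_gt0.
have [J2 HJ2] := truncX_cvg psi e20.
pose J := maxn m.+1 (maxn J1 J2).
have J1J : (J1 <= J)%N by rewrite /J !leq_max leqnn orbT.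
have J2J : (J2 <= J)%N by rewrite /J !leq_max leqnn !orbT.
pose Lf := mx_apply frag_mx (theta r d a) J f.
exists (truncX J f, truncX J Lf).
  by exists J, f; split => //; exact: leq_maxl.
split => /=; first exact: HJ1.
set tau := `|psi| - \sum_(n < J) n.+1%:R * `|psi n| in HJ2.
have := HJ2 _ J2J; rewrite -/tau => tau_lt.
rewrite (@le_lt_trans _ _ (tau + tau))//; last first.
  by rewrite [ltRHS](splitr e) ltrD.
apply: Xnorm_le => I.
(* Rows cut at [n]: the error is their limit in [n], so it inherits the bounds proved for finite
   sums. *)
pose G n i := \sum_(j < n) frag_mx i j * (f j - trunc J f j) -
  theta r d a i * (f i - trunc J f i).
have GE i : G n i @[n --> \oo] --> (g - truncX J Lf) i.
  have -> : (g - truncX J Lf) i =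
      (g i + theta r d a i * f i - \sum_(j < J) frag_mx i j * trunc J f j)
      - theta r d a i * (f i - trunc J f i).
    by rewrite XBE/= -mx_apply_trunc /mx_apply; ring.
  apply: cvgB; last exact: cvg_cst.
  apply: (@cvg_trans _ ((fun n => \sum_(j < n) frag_mx i j * f j -
      \sum_(j < J) frag_mx i j * trunc J f j) @ \oo)).
    apply: near_eq_cvg; near=> n.
    have Jn : (J <= n)%N by near: n; exact: nbhs_infty_ge.
    under [RHS]eq_bigr do rewrite mulrBr.
    rewrite sumrB; congr (_ - _).
    rewrite (big_ord_widen _ (fun j => frag_mx i j * trunc J f j) Jn).
    rewrite [RHS](bigID (fun j : 'I_n => (j < J)%N))/= [X in _ + X]big1 ?addr0// => j.
    by rewrite /trunc => /negbTE ->; rewrite mulr0.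
  have := @graphAB_cvg (f, g) i Gfg.
  by move=> /= lim_i; exact: (cvgB lim_i (cvg_cst _)).
have H : \sum_(i < I) i.+1%:R * `|G n i| @[n --> \oo] -->
    \sum_(i < I) i.+1%:R * `|(g - truncX J Lf) i|.
  apply: cvg_big => [|i _]; first exact: add_continuous.
  by apply: cvgM; [exact: cvg_cst|apply: cvg_norm; exact: GE].
rewrite -(cvg_lim (@Rhausdorff R) H); apply: limr_le; first by apply/cvg_ex; eexists; exact: H.
near=> n.
have psiE j : theta r d a j * (f j - trunc J f j) = psi j - trunc J psi j.
  by rewrite mulrBr /trunc; case: ifP; rewrite // mulr0.
apply: (@le_trans _ _ (\sum_(i < I) i.+1%:R * `|\sum_(j < n) frag_mx i j * (f j - trunc J f j)|
   + \sum_(i < I) i.+1%:R * `|theta r d a i * (f i - trunc J f i)|)).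
  rewrite -big_split/= ler_sum// => i _; rewrite -mulrDr ler_wpM2l//.
  exact: ler_normB.
rewrite lerD//; last first.
  by under eq_bigr do rewrite psiE; exact: sum_tail_le.
rewrite (le_trans (frag_mx_row_sum_le (fun j => f j - trunc J f j) _ _))//.
by under eq_bigr do rewrite psiE; exact: sum_tail_le.
Unshelve. all: by end_near. Qed.

Lemma closure_graphAB m : closure (graphAB r d a b) = closure (core_graph m).
Proof.
apply/seteqP; split.
  apply: subset_trans (closureS (@graphAB_core m)) _.
  by rewrite -(iffLR (closure_id _) (@closed_closure _ _)).
apply: closureS => -[f g] [J [h [_ /= -> ->]]]; exact: graphAB_trunc.
Qed.

End FragmentationMatrix.

(** * Spectral gap *)

Lemma limn_esup_lt {R : realType} (u : (\bar R)^nat) (x : \bar R) :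
  (limn_esup u < x)%E -> \forall n \near \oo, (u n < x)%E.
Proof.
move=> /ereal_inf_lt[_ [V Voo <-] supV]; apply: filterS Voo => n Vn.
by apply: le_lt_trans supV; apply: ereal_sup_ubound; exists n.
Qed.

(** Only finitely many indices lie below [N], and their positive distances to [theta m] have a
    positive minimum; from [N] on the distance is at least [1]. *)
Lemma uniform_gap {R : realType} (theta : R^nat) (m N : nat) :
  (forall n, n != m -> theta m < theta n) ->
  (forall n, (N <= n)%N -> theta m + 1 <= theta n) ->
  exists2 eps, 0 < eps & forall n, n != m -> theta m + 2 * eps <= theta n.
Proof.
move=> lt_th th_oo.
have [e e0 He] : exists2 e : R, 0 < e &
    forall n, (n < N)%N -> n != m -> theta m + e <= theta n.
  elim: {th_oo} N => [|N [e e0 He]]; first by exists 1.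
  have [Nm|Nm] := eqVneq N m.
    exists e => // n; rewrite ltnS leq_eqVlt => /predU1P[->|nN nm]; last exact: He.
    by rewrite Nm eqxx.
  exists (Num.min e (theta N - theta m)).
    by rewrite lt_min e0 subr_gt0 lt_th.
  move=> n; rewrite ltnS leq_eqVlt => /predU1P[->|nN nm].
    by move=> _; rewrite -lerBrDl ge_min lexx orbT.
  by rewrite (le_trans _ (He _ nN nm))// lerD2l ge_min lexx.
exists (Num.min e 1 / 2); first by rewrite divr_gt0// lt_min e0 ltr01.
move=> n nm; rewrite mulrC divfK//.
have [nN|Nn] := ltnP n N.
  by rewrite (le_trans _ (He _ nN nm))// lerD2l ge_min lexx.
by rewrite (le_trans _ (th_oo _ Nn))// lerD2l ge_min lexx orbT.
Qed.

(** A vanishing pairing determines coordinate [m], which [c] may ignore, from the others, with [K]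
    times the seminorm as a bound. *)
Lemma kernel_norm_le {R : realType} (es c : R^nat) (K W : R) (m : nat) (f : X R) :
  es m = 1 -> (forall n, 0 <= es n) -> (forall n, es n <= K * n.+1%:R) ->
  (forall n, 0 <= c n) -> (forall n, c n <= W) -> (forall n, n != m -> 1 <= c n) ->
  pairing es f = 0 ->
  `|f| <= (1 + m.+1%:R * K) * wnorm (fun n => c n * f n).
Proof.
move=> esm es0 esK c0 cW c1 Ff.
have esK' n : `|es n| <= K * n.+1%:R by rewrite ger0_norm.
have K0 := pairing_bound_ge0 esK'.
set V := wnorm _.
have off J (mo : 'I_J) : val mo = m -> \sum_(n < J | n != mo) n.+1%:R * `|f n| <= V.
  move=> mom; apply: le_trans (wnorm_mulE c0 cW f J).
  rewrite [leRHS](bigD1 mo)//= -[leLHS]add0r lerD ?mulr_ge0//.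
  by rewrite ler_sum// => n nm; rewrite ler_wpM2l// ler_peMl// c1// -mom.
have fm : `|f m| <= K * V.
  (* The kernel condition is an infinite sum; on a long truncation it holds up to [e], since the
     pairing is bounded by [K]. *)
  apply/ler_addgt0Pr => e e0.
  have e1 : 0 < e / (K + 1) by rewrite divr_gt0// ltr_wpDl.
  have [J0 HJ0] := truncX_dense f e1.
  pose J := maxn m.+1 J0; pose mo : 'I_J := Ordinal (leq_maxl m.+1 J0).
  have FJ : `|\sum_(n < J) es n * f n| <= e.
    have -> : \sum_(n < J) es n * f n = - pairing es (f - truncX J f).
      by rewrite (pairingB esK') Ff sub0r opprK pairing_trunc.
    rewrite normrN (le_trans (pairing_le esK' _))//.
    apply: (@le_trans _ _ ((K + 1) * (e / (K + 1)))).
      by rewrite ler_pM ?lerDl// ltW// HJ0// leq_maxr.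
    by rewrite mulrC divfK// gt_eqF// ltr_wpDl.
  rewrite (bigD1 mo)//= esm mul1r in FJ.
  have tl : `|\sum_(n < J | n != mo) es n * f n| <= K * V.
    rewrite (le_trans (ler_norm_sum _ _ _))//.
    apply: le_trans (ler_wpM2l K0 (off _ mo erefl)); rewrite mulr_sumr ler_sum// => n _.
    by rewrite normrM mulrA ler_wpM2r.
  rewrite -(addrK (\sum_(n < J | n != mo) es n * f n) (f m)).
  by rewrite (le_trans (ler_normB _ _))// addrC lerD.
apply: Xnorm_le => J.
have [Jm mJ] := (leq_maxl J m.+1, leq_maxr J m.+1).
apply: (le_trans (@ler_sum_ord _ (fun n => n.+1%:R * `|f n|) _ _ _ Jm)).
  by move=> n; rewrite mulr_ge0.
rewrite (bigD1 (Ordinal mJ))//= mulrDl mul1r addrC lerD ?off//.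
by rewrite -mulrA ler_wpM2l.
Qed.

Theorem theorem3p1 (R : realType) (r d a : R^nat) (b : nat -> R^nat)
    (coefs : decay_fragmentation_coefficients r d a b)
    (S : R -> X R -> X R) (SG : decay_fragmentation_semigroup r d a b S)
    (hC : exists2 C : R, 0 < C & forall n, C * r n <= d n + a n)
    (hd : \forall n \near \oo, 0 < d n)
    (had : (limn_esup (fun n => (a n / d n)%:E) < +oo)%E)
    (htheta : limn_einf (fun n => (theta r d a n)%:E) = +oo%E)
    (hmin : exists! m, forall n, theta r d a m <= theta r d a n)
    (lambda1 : R) (hlambda1 : lambda1 = - inf (range (theta r d a))) :
  exists (eps M : R) (e : X R) (es : R^nat),
    [/\ 0 < eps, 1 <= M, Xdual es &
        forall (f : X R) (t : R), 0 <= t ->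
          `|expR (- lambda1 * t) *: S t f - pairing es f *: e|
            <= M * expR (- eps * t) * `|f| ].
Proof.
have a0 := frag_ge0 coefs.
have [C C0 HC] := hC.
have HC' n : theta r d a n <= (C^-1 + 1) * prate d a n.
  rewrite /theta /prate mulrDl mul1r -addrA lerD2r.
  by rewrite -(ler_pM2l C0) mulVKf ?gt_eqF// addrC HC.
have theta_prate : exists C' : R, forall n, theta r d a n <= C' * prate d a n.
  by exists (C^-1 + 1).
have theta_oo A : exists N, forall n, (N <= n)%N -> A <= theta r d a n.
  have : (limn_esup (\- (fun n => (theta r d a n)%:E)) < (- A)%:E)%E.
    by move: htheta; rewrite /limn_einf => /(congr1 -%E); rewrite oppeK => ->; exact: ltNyr.
  move=> /limn_esup_lt[N _ HN]; exists N => n /HN /=.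
  by rewrite lte_fin ltrN2 => /ltW.
(* The difference is [d n], and eventually [theta n <= (C^-1 + 1) * (k + 1) * d n], so the
   divergence of [theta] passes to [d]. *)
have death_oo A : exists N, forall n, (N <= n)%N -> A <= theta r d a n - frag_rate r a n.
  have C'0 : 0 < C^-1 + 1 by rewrite addr_gt0// invr_gt0.
  have [k /andP[k0 had']] : exists k : R, (0 < k) && (limn_esup (fun n => (a n / d n)%:E) < k%:E)%E.
    case: limn_esup had => [x _||] //.
      exists (`|x| + 1); rewrite ltr_wpDl// lte_fin.
      by rewrite (le_lt_trans (ler_norm x))// ltrDl.
    by move=> _; exists 1; rewrite ltr01 ltNyr.
  have [N1 _ HN1] := limn_esup_lt had'.
  have [N2 _ HN2] := hd.
  have [N3 HN3] := theta_oo (A * ((C^-1 + 1) * (k + 1))).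
  exists (maxn N1 (maxn N2 N3)) => n; rewrite !geq_max => /and3P[n1 n2 n3].
  have dn : 0 < d n by exact: HN2.
  have adn : a n <= k * d n.
    by have := HN1 n n1; rewrite /= lte_fin ltr_pdivrMr// => /ltW.
  have -> : theta r d a n - frag_rate r a n = d n by rewrite /theta /frag_rate; ring.
  have c0 : 0 < (C^-1 + 1) * (k + 1) by rewrite mulr_gt0// addr_gt0.
  rewrite -(ler_pM2r c0) (le_trans (HN3 n n3))// (le_trans (HC' n))//.
  by rewrite [leRHS]mulrC -mulrA ler_wpM2l ?(ltW C'0)// /prate mulrDl mul1r lerD2r.
have [m [min_m uniq_m]] := hmin.
set th := theta r d a in min_m uniq_m theta_prate theta_oo death_oo *.
have lt_m n : n != m -> th m < th n.
  move=> nm; rewrite ltNge; apply/negP => le_nm.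
  by move/eqP: nm; apply; apply/esym/uniq_m => k; exact: le_trans (min_m k).
have thm0 : 0 < th m.
  by rewrite /th /theta -addrA ltr_wpDr ?(decay_gt0 coefs)// addr_ge0// (death_ge0 coefs).
have [N HN] := theta_oo (th m + 1).
have [eps eps0 gap] := uniform_gap lt_m HN.
have {}hlambda1 : - lambda1 = th m.
  rewrite hlambda1 opprK; apply/eqP; rewrite eq_le; apply/andP; split.
    by apply: ge_inf; [exists (th m) => _ [n _ <-]|exists m].
  by apply: lb_le_inf; [exists (th m); exists m|move=> _ [n _ <-]].
have [es [K [esm es_lt es_ge0 esK esig]]] := left_eigenvector (frag_mx_ge0 coefs)
  (frag_mx_col coefs) (frag_rate_ge0 coefs) death_oo eps0 gap.
have esK' n : `|es n| <= K * n.+1%:R by rewrite ger0_norm.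
have K0 := pairing_bound_ge0 esK'.
(* Now [kap = K], which reserves room for coordinate [m], controlled on the kernel of [es] through
   [esK]. *)
have [p [W [p1 pW pP]]] := exists_weight (frag_mx_ge0 coefs)
  (frag_mx_col coefs) (frag_rate_ge0 coefs) death_oo eps0 gap K0.
have [e0 [e0m e0_gt eeig]] := right_eigenvector (frag_mx_tri coefs) eps0 gap.
pose c n := if n == m then 0 else p n.
have cm : c m = 0 by rewrite /c eqxx.
have cp n : n != m -> c n = p n by rewrite /c => /negbTE ->.
have c_ge0 n : 0 <= c n by rewrite /c; case: ifP; rewrite // (le_trans _ (p1 n)).
have cW n : c n <= W.
  by rewrite /c; case: ifP => // _; rewrite (le_trans _ (pW 0))// (le_trans _ (p1 0)).
have c1 n : n != m -> 1 <= c n by move=> /cp ->.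
have W0 : 0 <= W by exact: le_trans (c_ge0 0) (cW 0).
pose L J := mx_apply (frag_mx r a b) th J.
pose e := truncX m.+1 e0.
have eJ J : (m < J)%N -> e = truncX J e0.
  move=> mJ; apply/val_inj/funext => n; rewrite /= /trunc ltnS.
  case: (leqP n m) => [nm|/e0_gt->]; last by case: ifP.
  by rewrite (leq_ltn_trans nm mJ).
have Le J : (m < J)%N -> L J e0 = - th m *: e0.
  move=> mJ; apply/funext => i; rewrite /L /mx_apply.
  have -> : \sum_(j < J) frag_mx r a b i j * e0 j = (th i - th m) * e0 i.
    rewrite -eeig (big_ord_widen _ (fun j => frag_mx r a b i j * e0 j) mJ).
    rewrite (bigID (fun j : 'I_J => (j < m.+1)%N))/= [X in _ + X]big1 ?addr0// => j.
    by rewrite -ltnNge => /e0_gt ->; rewrite mulr0.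
  rewrite [RHS](_ : _ = - th m * e0 i)//; ring.
pose F (f : X R) := pairing es f.
have FD u v : F (u + v) = F u + F v by exact: pairingD esK' u v.
have FB u v : F (u - v) = F u - F v by exact: pairingB esK' u v.
have FZ z u : F (z *: u) = z * F u by exact: pairingZ esK' z u.
have Fe : F e = 1.
  rewrite /F pairing_trunc big_ord_recr/= esm e0m mulr1 big1 ?add0r// => n _.
  by rewrite es_lt ?mul0r.
have FL J (f : R^nat) : F (truncX J (L J f)) = - th m * F (truncX J f).
  by rewrite /F !pairing_trunc (@left_eigenvector_apply _ _ th m (frag_mx_tri coefs) es J f esig).
have GD : generator S = closure (core_graph r d a b m).
  by rewrite (dfs_generator SG) (closure_graphAB coefs theta_prate m).
have dense (f : X R) x : 0 < x -> exists2 fg, core_graph r d a b m fg & `|f - fg.1| < x.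
  move=> /(truncX_dense f)[J0 HJ0]; pose J := maxn m.+1 J0.
  exists (truncX J f, truncX J (L J f)); last by apply: HJ0; exact: leq_maxr.
  by exists J, f; split; rewrite //= leq_maxl.
have C0S := dfs_C0 SG; have SC := dfs_contractive SG.
(* Invariance of the kernel: on the core, [F] turns the resolvent step into multiplication by
   [1 + h * th m], so [seminorm_decay] applies to the absolute value of [F]. *)
have FS (f : X R) (t : R) : 0 <= t -> F f = 0 -> F (S t f) = 0.
  move=> t0 Ff; apply/eqP; rewrite -normr_le0.
  have th2 : 0 < th m / 2 by rewrite divr_gt0.
  have th2' : th m / 2 < th m by rewrite ltr_pdivrMr// mulr_natr mulr2n ltrDl.
  have := @seminorm_decay _ _ S C0S SC (fun f => `|F f|) K _ _ _ _ _ _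
    K0 th2 th2' GD dense _ f t t0.
  rewrite Ff normr0 mulr0; apply.
  - by move=> u v; rewrite FD ler_normD.
  - exact: pairing_le.
  - by [].
  move=> [u v] h [J [g [_ /= -> ->]]] h0.
  have hth0 : 0 <= 1 + h * th m by rewrite addr_ge0// mulr_ge0 ?(ltW h0) ?(ltW thm0).
  rewrite FB FZ FL (_ : _ - _ = (1 + h * th m) * F (truncX J g)); last by ring.
  by rewrite normrM (ger0_norm hth0).
(* [Q] is the projection onto the kernel of [F] along [e], because [F e = 1]. *)
pose Q (f : X R) : X R := f - F f *: e.
pose V (f : X R) := wnorm (fun n => c n * f n).
have FQ f : F (Q f) = 0.
  by rewrite /Q FB FZ Fe mulr1 subrr.
have QD f g : Q (f + g) = Q f + Q g.
  by rewrite /Q FD scalerDl opprD addrACA.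
have QB f g h : Q (f - h *: g) = Q f - h *: Q g.
  rewrite /Q FB FZ scalerBl scalerBr !opprB scalerA.
  by rewrite addrACA [RHS]addrACA; congr (_ + _); exact: addrC.
have Qker f : F f = 0 -> Q f = f by rewrite /Q => ->; rewrite scale0r subr0.
have Qle f : `|Q f| <= (1 + K * `|e|) * `|f|.
  rewrite (le_trans (ler_normB _ _))// mulrDl mul1r lerD2l normrZ mulrAC.
  by rewrite ler_wpM2r// pairing_le.
have QJ J (f : R^nat) : (m < J)%N -> Q (truncX J f) = truncX J (f - F (truncX J f) *: e0).
  by move=> mJ; rewrite /Q truncXB truncXZ -eJ.
(* [Q] commutes with the matrix since [es] and [e0] are left and right eigenvectors for the same
   eigenvalue. *)
have QL J (f : R^nat) : (m < J)%N ->
    Q (truncX J (L J f)) = truncX J (L J (f - F (truncX J f) *: e0)).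
  move=> mJ; rewrite QJ// FL; congr truncX; set z := F _.
  have -> : L J (f - z *: e0) = L J f - z *: L J e0.
    apply/funext => i; rewrite /L /mx_apply.
    rewrite [LHS](_ : _ = \sum_(j < J) (frag_mx r a b i j * f j - z * (frag_mx r a b i j * e0 j))
        - th i * (f i - z * e0 i)); last first.
      by congr (_ - _); apply: eq_bigr => j _; rewrite /= mulrBr; congr (_ - _); rewrite mulrCA.
    rewrite sumrB -mulr_sumr.
    set x := \sum_(j < J) _; set y := \sum_(j < J) _.
    rewrite [RHS](_ : _ = x - th i * f i - z * (y - th i * e0 i)); last by [].
    ring.
  by rewrite Le// !scalerA mulrC.
(* Half of [eps] is given up because [seminorm_decay] needs a rate strictly below the dissipativity
   rate [th m + eps]. *)
have decay f (t : R) : 0 <= t ->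
    V (Q (S t f)) <= expR (- (th m + eps / 2) * t) * V (Q f).
  move=> t0.
  have w'0 : 0 < th m + eps / 2 by rewrite addr_gt0// divr_gt0.
  have w'w : th m + eps / 2 < th m + eps.
    by rewrite ltrD2l ltr_pdivrMr// mulr_natr mulr2n ltrDl.
  have K'0 : 0 <= W * (1 + K * `|e|) by rewrite mulr_ge0// addr_ge0// mulr_ge0.
  apply: (@seminorm_decay _ _ S C0S SC (fun f => V (Q f)) _ _ _ _ _ _ _
    K'0 w'0 w'w GD dense _ f t t0).
  - by move=> u v; rewrite QD; exact: (wnorm_mulD c_ge0 cW).
  - move=> u; rewrite -mulrA (le_trans (wnorm_mul_le c_ge0 cW _))// ler_wpM2l//.
  - by move=> u; exact: (wnorm_mul_ge0 c_ge0 cW).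
  move=> [u v] h [J [g [mJ /= -> ->]]] h0.
  rewrite QB QL// QJ//; set g' := g - _.
  rewrite -truncXZ -truncXB /V !(wnorm_mul_trunc c_ge0 cW).
  have Fg' : \sum_(n < J) es n * g' n = 0.
    by rewrite -pairing_trunc /g' -QJ//; exact: FQ.
  exact: (dissipative_off_eigenvalue (frag_mx_ge0 coefs) (frag_mx_tri coefs)
    esm es_lt es_ge0 esK p1 pP mJ h0 (theta_ge0 coefs) Fg' cm cp).
have Se (t : R) : 0 <= t -> S t e = expR (- th m * t) *: e.
  apply: (semigroup_eigenvector C0S SC (ltW thm0)).
  rewrite GD; apply: subset_closure; exists m.+1, e0; split => //=.
  by rewrite -/(L _ _) Le// truncXZ.
(* The first factor returns from the seminorm to the norm on the kernel; the other two bound the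
   weight and the projection. *)
pose M := (1 + m.+1%:R * K) * (W * (1 + K * `|e|)).
exists (eps / 2), (Num.max 1 M), e, es; split.
- by rewrite divr_gt0.
- by rewrite le_max lexx.
- exact: (Xdual_bound esK').
move=> f t t0; rewrite hlambda1.
(* The component of [f] along [e] evolves by [expR (- th m * t)], so subtracting it leaves the
   rescaled orbit of [Q f]. *)
have -> : expR (th m * t) *: S t f - pairing es f *: e = expR (th m * t) *: S t (Q f).
  have -> : Q f = - F f *: e + f by rewrite /Q addrC scaleNr.
  rewrite (semigroup_linear C0S t0) Se// scalerDr [RHS]addrC !scalerA; congr (_ + _).
  by rewrite mulrAC (mulNr (th m)) expRxMexpNx_1 mul1r scaleNr.
rewrite normrZ (ger0_norm (expR_ge0 _)).
have FSQ : F (S t (Q f)) = 0 by exact: FS.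
have h1 := kernel_norm_le esm es_ge0 esK c_ge0 cW c1 FSQ.
have h2 := decay (Q f) t t0; rewrite (Qker _ FSQ) (Qker _ (FQ f)) in h2.
have h3 : V (Q f) <= W * (1 + K * `|e|) * `|f|.
  by rewrite -mulrA (le_trans (wnorm_mul_le c_ge0 cW _))// ler_wpM2l.
have K1 : 0 <= 1 + m.+1%:R * K by rewrite addr_ge0// mulr_ge0.
have h4 : `|S t (Q f)| <= M * (expR (- (th m + eps / 2) * t) * `|f|).
  apply: (le_trans h1); rewrite /M -mulrA ler_wpM2l//; apply: (le_trans h2).
  by rewrite mulrCA ler_wpM2l// expR_ge0.
apply: (le_trans (ler_wpM2l (expR_ge0 _) h4)).
rewrite mulrCA [X in _ * X]mulrA -expRD.
have -> : th m * t + - (th m + eps / 2) * t = - (eps / 2) * t by ring.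
by rewrite mulrA ler_wpM2r// ler_wpM2r ?expR_ge0// le_max lexx orbT.
Qed.
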